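(* Let $F$ be an algebraically closed field of characteristic different from $2$, let $\mathbf{O}$ be the octonion algebra over $F$, $G=\mathrm{Aut}(\mathbf{O})$, and $SO(7)=\mathrm{Stab}_{SO(8)}(1_{\mathbf{O}})\subset PSO(8)$. With the triality automorphism $\rho$ of $PSO(8)$ and the closed subvariety $V=\{P_x\mid x\in M\}$ of $PSO(8)$ described in the context, the morphism $$f:SO(7)\to V,\qquad f(h)=h^{\rho^2}h^{-\rho},$$ can be identified with the factor-morphism $SO(7)\to SO(7)/G$; that is, $f$ induces an isomorphism of varieties $SO(7)/G\to V$, $hG\mapsto f(h)$.
   Context: $\mathbf{O}$ is the Zorn vector-matrix algebra over $F$, consisting of all $a=\begin{pmatrix}\alpha&\mathbf{u}\\ \mathbf{v}&\beta\end{pmatrix}$ with $\alpha,\beta\in F$, $\mathbf{u},\mathbf{v}\in F^3$, and multiplication $$\begin{pmatrix}\alpha&\mathbf{u}\\ \mathbf{v}&\beta\end{pmatrix}\begin{pmatrix}\alpha'&\mathbf{u}'\\ \mathbf{v}'&\beta'\end{pmatrix}=\begin{pmatrix}\alpha\alpha'+\mathbf{u}\cdot\mathbf{v}'&\alpha\mathbf{u}'+\beta'\mathbf{u}-\mathbf{v}\times\mathbf{v}'\\ \alpha'\mathbf{v}+\beta\mathbf{v}'+\mathbf{u}\times\mathbf{u}'&\beta\beta'+\mathbf{v}\cdot\mathbf{u}'\end{pmatrix}.$$ Norm $n(a)=\alpha\beta-\mathbf{u}\cdot\mathbf{v}$ with associated bilinear form $q$; $\mathbf{O}_1=\{a: n(a)=1\}$.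 $SO(8)=SO(\mathbf{O},q)$ is generated by $L_x:z\mapsto xz$ and $R_x:z\mapsto zx$ for $x\in\mathbf{O}_1$; $PSO(8)=SO(8)/\{\pm E\}$. For $x\in M=\mathbf{O}_1/\{\pm1_{\mathbf{O}}\}$ write $L_x,R_x$ also for the induced elements of $PSO(8)$, and put $P_x=L_x^{-1}R_x^{-1}$. The triality automorphism $\rho$ of $PSO(8)$ is the automorphism of order $3$ determined by $R_x^\rho=P_x$, $L_x^\rho=R_x$, $P_x^\rho=L_x$ for all $x\in M$. Here $h^{\rho^2}$ is the image of $h$ under $\rho^2$ and $h^{-\rho}=(h^{\rho})^{-1}$. $SO(7)$ is identified with its image in $PSO(8)$; $G\subset SO(7)$ is the subgroup of elements fixed by $\rho$. The set $V$ is a closed irreducible subvariety of $PSO(8)$, and $f$ takes values in $V$. *)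

(* Defs.v *)
From mathcomp Require Import all_boot all_order all_algebra.
From mathcomp Require Import mpoly.
From mathcomp Require Import boolp classical_sets functions.

Set Implicit Arguments.
Unset Strict Implicit.
Unset Printing Implicit Defensive.

Import GRing.Theory.
Local Open Scope ring_scope.
Local Open Scope classical_set_scope.

(** * Spaces with functions

    Varieties are treated as spaces with functions: a set of points with a
    topology and, for each open set [W], the [F]-valued functions regular on
    [W].  Points live in an ambient type [T]; functions are total on [T] but
    only their values at points of [W] are relevant to being regular on [W]. *)

Record fspace (F : fieldType) (T : Type) := FSpace {
  points : set T;
  opens : set (set T);
  regular : set T -> set (T -> F) }.

Section FunctionSpaces.
Variable F : fieldType.

Definition mxeval m n (p : {mpoly F[m * n]}) (A : 'M[F]_(m, n)) : F :=
  p.@[fun i => mxvec A 0 i].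

(* Affine space of all matrices: Zariski topology, and functions which are
   locally quotients of polynomials in the entries. *)
Definition mxspace m n : fspace F 'M[F]_(m, n) := {|
  points := setT;
  opens := [set W | exists E : set {mpoly F[m * n]},
              W = [set A | exists2 p, E p & mxeval p A != 0]];
  regular := fun W => [set g | forall A, W A ->
              exists a b : {mpoly F[m * n]}, mxeval b A != 0 /\
                forall B, W B -> mxeval b B != 0 -> g B = mxeval a B / mxeval b B] |}.

(* Induced structure on a subset: subspace topology, and functions which are
   locally restrictions of regular functions of the ambient space. *)
Definition subspace T (X : fspace F T) (S : set T) : fspace F T := {|
  points := points X `&` S;
  opens := [set W | exists2 U, opens X U & W = U `&` S];
  regular := fun W => [set g | forall x, W x ->
              exists U (h : T -> F), [/\ opens X U, U x, regular X U h &
                forall y, W y -> U y -> g y = h y]] |}.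

(* Quotient structure along [c]: a set is open iff its preimage is, and a
   function is regular iff its pullback is. *)
Definition quotient_space T T' (X : fspace F T) (c : T -> T') : fspace F T' := {|
  points := c @` points X;
  opens := [set W | W `<=` c @` points X /\ opens X (points X `&` c @^-1` W)];
  regular := fun W => [set g : T' -> F | regular X (points X `&` c @^-1` W) (g \o c)] |}.

Definition is_morphism T T' (X : fspace F T) (Y : fspace F T') (phi : T -> T') :=
  (forall x, points X x -> points Y (phi x)) /\
  (forall W, opens Y W ->
     opens X (points X `&` phi @^-1` W) /\
     forall g, regular Y W g -> regular X (points X `&` phi @^-1` W) (g \o phi)).

Definition is_isomorphism T T' (X : fspace F T) (Y : fspace F T') (phi : T -> T') :=
  is_morphism X Y phi /\
  exists psi : T' -> T,
    [/\ is_morphism Y X psi,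
        forall x, points X x -> psi (phi x) = x &
        forall y, points Y y -> phi (psi y) = y].

Section Cosets.
Variable n : nat.
Implicit Types (A : 'M[F]_n) (H K X Y : set 'M[F]_n).

Definition lcoset A K : set 'M[F]_n := [set A *m B | B in K].

(* For matrix groups K <= H, the quotient variety H / K. *)
Definition coset_space H K : fspace F (set 'M[F]_n) :=
  quotient_space (subspace (mxspace n n) H) (lcoset ^~ K).

Definition coset_mul X Y : set 'M[F]_n := [set A *m B | A in X & B in Y].
Definition coset_inv X : set 'M[F]_n := [set invmx A | A in X].

End Cosets.

End FunctionSpaces.

(** * The Zorn vector-matrix algebra

    An octonion (alpha, u; v, beta) is stored as the column of its eight
    coordinates, so that linear operators are 8 x 8 matrices acting on the
    left, and the product of operators is composition. *)

Notation octonion F := 'cV[F]_(1 + 3 + (3 + 1)).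
Notation operator F := 'M[F]_(1 + 3 + (3 + 1)).

Section Octonions.
Variable F : fieldType.
Implicit Types (x y z a : octonion F) (h A : operator F).

Definition dot (u v : 'cV[F]_3) : F := \sum_i u i 0 * v i 0.

(* Indices are added in 'I_3, i.e. modulo 3. *)
Definition cross (u v : 'cV[F]_3) : 'cV[F]_3 :=
  \col_i (u (i + 1) 0 * v (i + 2%:R) 0 - u (i + 2%:R) 0 * v (i + 1) 0).

Definition zorn (al : F) (u v : 'cV[F]_3) (be : F) : octonion F :=
  col_mx (col_mx al%:M u) (col_mx v be%:M).

Definition zalpha a : F := usubmx (usubmx a) 0 0.
Definition zu a : 'cV[F]_3 := dsubmx (usubmx a).
Definition zv a : 'cV[F]_3 := usubmx (dsubmx a).
Definition zbeta a : F := dsubmx (dsubmx a) 0 0.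

Definition omul a b : octonion F :=
  zorn (zalpha a * zalpha b + dot (zu a) (zv b))
       (zalpha a *: zu b + zbeta b *: zu a - cross (zv a) (zv b))
       (zalpha b *: zv a + zbeta a *: zv b + cross (zu a) (zu b))
       (zbeta a * zbeta b + dot (zv a) (zu b)).

Definition oone : octonion F := zorn 1 0 0 1.

Definition onorm a : F := zalpha a * zbeta a - dot (zu a) (zv a).
Definition oform a b : F := onorm (a + b) - onorm a - onorm b.

Definition O1 : set (octonion F) := [set x | onorm x = 1].

Definition mx_of_fun (g : octonion F -> octonion F) : operator F :=
  \matrix_(i, j) g (delta_mx j 0) i 0.

Definition Lop x : operator F := mx_of_fun (fun z => omul x z).
Definition Rop x : operator F := mx_of_fun (fun z => omul z x).
Definition Pop x : operator F := invmx (Lop x) *m invmx (Rop x).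

Definition SO8 : set (operator F) :=
  [set h | \det h = 1 /\ forall x y, oform (h *m x) (h *m y) = oform x y].

Definition SO7 : set (operator F) := [set h | SO8 h /\ h *m oone = oone].

Definition AutO : set (operator F) :=
  [set h | h \in unitmx /\
           forall x y, h *m omul x y = omul (h *m x) (h *m y)].

(** * PSO(8) and triality *)

Definition pmE : set (operator F) := [set 1%:M; - 1%:M].

Definition PSO8 : fspace F (set (operator F)) := coset_space SO8 pmE.

Definition pclass h : set (operator F) := lcoset h pmE.

(* L_x, R_x, P_x in PSO(8) depend only on the image of x in M = O_1 / {1, -1},
   so that quantifying over x in O_1 amounts to quantifying over M. *)
Definition Lbar x := pclass (Lop x).
Definition Rbar x := pclass (Rop x).
Definition Pbar x := pclass (Pop x).

Definition V_variety : fspace F (set (operator F)) := subspace PSO8 (Pbar @` O1).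

(* [rho] is an automorphism of the abstract group PSO(8), of order 3, with
   R_x -> P_x, L_x -> R_x, P_x -> L_x. Values of [rho] outside PSO(8) are
   irrelevant. *)
Record is_triality (rho : set (operator F) -> set (operator F)) : Prop := {
  triality_bij : set_bij (points PSO8) (points PSO8) rho;
  triality_mul : forall X Y, points PSO8 X -> points PSO8 Y ->
    rho (coset_mul X Y) = coset_mul (rho X) (rho Y);
  triality_order3 : forall X, points PSO8 X -> rho (rho (rho X)) = X;
  triality_neq_id : exists2 X, points PSO8 X & rho X <> X;
  triality_R : forall x, O1 x -> rho (Rbar x) = Pbar x;
  triality_L : forall x, O1 x -> rho (Lbar x) = Rbar x;
  triality_P : forall x, O1 x -> rho (Pbar x) = Lbar x }.

(* SO(7) is identified with its image in PSO(8) via h |-> pclass h. *)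
Definition fmap (rho : set (operator F) -> set (operator F)) h
    : set (operator F) :=
  coset_mul (rho (rho (pclass h))) (coset_inv (rho (pclass h))).

Definition SO7_variety : fspace F (operator F) := subspace (mxspace F _ _) SO7.

Definition SO7_mod_G : fspace F (set (operator F)) := coset_space SO7 AutO.

End Octonions.

(* Main.v *)
Require Import Defs.
From mathcomp Require Import all_boot all_order all_algebra.
From mathcomp Require Import mpoly.
From mathcomp Require Import ring.
From mathcomp Require Import boolp classical_sets functions.

(** The theorem comes from the relation h(xy) = h1(x) h2(y) between elements of SO(8).

    For n(a) = 1 the middle Moufang identity says that B_a = L_a R_a satisfies it with
    h1 = L_a and h2 = R_a. The prescribed values of rho give rho(B_a) = L_{conj a} and
    rho^2(B_a) = R_{conj a}, which are kappa R_a kappa and kappa L_a kappa for the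
    conjugation kappa. Both facts are multiplicative. An element of SO(7) is a product of
    an even number of reflections in imaginary units, and the product of two of them is
    B_a B_b; so every h in SO(7) has a triple (h, h1, h2) such that rho(h) and rho^2(h)
    are the classes of kappa h2 kappa and kappa h1 kappa ([SO7_related]). Because h fixes
    1, one gets h1 = R_c h and h2 = L_{conj c} h with c = h1(1) of norm 1, and then
    f(h) = P_c ([fmap_Pbar]).

    The fibres of f are the cosets of G: f(h) = f(k) makes the octonion c of h^-1 k
    central, hence 1 or -1, and then h^-1 k is multiplicative ([fmap_eq]). Every c of norm
    1 occurs: choose a imaginary, anisotropic and orthogonal to c; then b = ac is imaginary
    and the composite of the reflections in a and b has image P_c ([lift_twistP]).

    That f is a morphism is not visible from c, which is determined only up to sign. But
    R_c^-1 L_x R_c = h L_{h^-1 x} h^-1 is polynomial in h, and the L_x generate all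
    operators; an explicit word in them is z |-> t(z) 1, whose conjugate by R_c is
    z |-> q(z, conj c) conj c. This determines P_c polynomially in h ([theta_Pbar]).

    The inverse V -> SO(7)/G is a morphism because f has local sections in the Zariski
    topology. From a matrix representing P_c up to sign, quadratic expressions give a
    multiple of conj c; the elements built from a and ac as above, with a chosen linearly
    in c, are homogeneous of degree 0, and give a section near one point of V. The
    group SO(7) acts on V by X |-> rho^2(k) X rho(k)^-1, f is equivariant, and so the
    section is carried to every point ([local_section]). These sections take the same
    value on A and -A, so they are defined on open subsets of PSO(8). *)

Set Implicit Arguments.
Unset Strict Implicit.
Unset Printing Implicit Defensive.

Import GRing.Theory.
Local Open Scope ring_scope.

(** * Octonions in coordinates *)

Section Coordinates.
Variable F : fieldType.
Implicit Types (a b c x y z : octonion F).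

Definition col3 (r s t : F) : 'cV[F]_3 := \col_i nth 0 [:: r; s; t] i.

Definition oct (al r s t r' s' t' be : F) : octonion F :=
  zorn al (col3 r s t) (col3 r' s' t') be.

Lemma col3P (u : 'cV[F]_3) : u = col3 (u 0 0) (u 1 0) (u 2%:R 0).
Proof.
apply/colP => i; rewrite mxE.
by case: i => [[|[|[|//]]] Hi] /=; congr (u _ _); apply/val_inj.
Qed.

Lemma zornP z : z = zorn (zalpha z) (zu z) (zv z) (zbeta z).
Proof.
rewrite /zorn /zalpha /zbeta -!mx11_scalar /zu /zv.
by rewrite !vsubmxK.
Qed.

Lemma octP z : exists al r s t r' s' t' be, z = oct al r s t r' s' t' be.
Proof.
rewrite [z]zornP [zu z]col3P [zv z]col3P.
by do 8!eexists.
Qed.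

Lemma zalphaE al u v be : zalpha (zorn al u v be : octonion F) = al.
Proof. by rewrite /zalpha /zorn !col_mxKu mxE. Qed.
Lemma zbetaE al u v be : zbeta (zorn al u v be : octonion F) = be.
Proof. by rewrite /zbeta /zorn !col_mxKd mxE. Qed.
Lemma zuE al u v be : zu (zorn al u v be : octonion F) = u.
Proof. by rewrite /zu /zorn col_mxKu col_mxKd. Qed.
Lemma zvE al u v be : zv (zorn al u v be : octonion F) = v.
Proof. by rewrite /zv /zorn col_mxKd col_mxKu. Qed.

Lemma zornD al u v be al' u' v' be' :
  zorn al u v be + zorn al' u' v' be' = zorn (al + al') (u + u') (v + v') (be + be') :> octonion F.
Proof. by rewrite /zorn !add_col_mx !raddfD. Qed.
Lemma zornZ k al u v be :
  k *: zorn al u v be = zorn (k * al) (k *: u) (k *: v) (k * be) :> octonion F.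
Proof. by rewrite /zorn !scale_col_mx !scale_scalar_mx. Qed.

Lemma col3D r s t r' s' t' : col3 r s t + col3 r' s' t' = col3 (r + r') (s + s') (t + t').
Proof. by rewrite [LHS]col3P !mxE. Qed.
Lemma col3Z k r s t : k *: col3 r s t = col3 (k * r) (k * s) (k * t).
Proof. by rewrite [LHS]col3P !mxE. Qed.
Lemma dot3 r s t r' s' t' : dot (col3 r s t) (col3 r' s' t') = r * r' + s * s' + t * t'.
Proof. by rewrite /dot !big_ord_recr big_ord0 /= !mxE /= add0r. Qed.
Lemma cross3 r s t r' s' t' : cross (col3 r s t) (col3 r' s' t') =
  col3 (s * t' - t * s') (t * r' - r * t') (r * s' - s * r').
Proof. by rewrite [LHS]col3P !mxE. Qed.
Lemma octD r0 r1 r2 r3 r4 r5 r6 r7 s0 s1 s2 s3 s4 s5 s6 s7 :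
  oct r0 r1 r2 r3 r4 r5 r6 r7 + oct s0 s1 s2 s3 s4 s5 s6 s7 =
  oct (r0 + s0) (r1 + s1) (r2 + s2) (r3 + s3) (r4 + s4) (r5 + s5) (r6 + s6) (r7 + s7).
Proof. by rewrite /oct zornD !col3D. Qed.
Lemma octZ k r0 r1 r2 r3 r4 r5 r6 r7 :
  k *: oct r0 r1 r2 r3 r4 r5 r6 r7 =
  oct (k * r0) (k * r1) (k * r2) (k * r3) (k * r4) (k * r5) (k * r6) (k * r7).
Proof. by rewrite /oct zornZ !col3Z. Qed.
Lemma octN r0 r1 r2 r3 r4 r5 r6 r7 :
  - oct r0 r1 r2 r3 r4 r5 r6 r7 =
  oct (- r0) (- r1) (- r2) (- r3) (- r4) (- r5) (- r6) (- r7).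
Proof. by rewrite -scaleN1r octZ !mulN1r. Qed.

Lemma omul_oct r0 r1 r2 r3 r4 r5 r6 r7 s0 s1 s2 s3 s4 s5 s6 s7 :
  omul (oct r0 r1 r2 r3 r4 r5 r6 r7) (oct s0 s1 s2 s3 s4 s5 s6 s7) =
  oct (r0 * s0 + (r1 * s4 + r2 * s5 + r3 * s6))
      (r0 * s1 + s7 * r1 - (r5 * s6 - r6 * s5))
      (r0 * s2 + s7 * r2 - (r6 * s4 - r4 * s6))
      (r0 * s3 + s7 * r3 - (r4 * s5 - r5 * s4))
      (s0 * r4 + r7 * s4 + (r2 * s3 - r3 * s2))
      (s0 * r5 + r7 * s5 + (r3 * s1 - r1 * s3))
      (s0 * r6 + r7 * s6 + (r1 * s2 - r2 * s1))
      (r7 * s7 + (r4 * s1 + r5 * s2 + r6 * s3)).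
Proof.
rewrite /omul /oct !zalphaE !zbetaE !zuE !zvE !dot3 !cross3 !col3Z.
by rewrite -[- col3 _ _ _]scaleN1r !col3Z !col3D !mulN1r.
Qed.

Lemma onorm_oct r0 r1 r2 r3 r4 r5 r6 r7 :
  onorm (oct r0 r1 r2 r3 r4 r5 r6 r7) = r0 * r7 - (r1 * r4 + r2 * r5 + r3 * r6).
Proof. by rewrite /onorm /oct zalphaE zbetaE zuE zvE dot3. Qed.

Definition oconj z : octonion F := zorn (zbeta z) (- zu z) (- zv z) (zalpha z).

Lemma oconj_oct r0 r1 r2 r3 r4 r5 r6 r7 :
  oconj (oct r0 r1 r2 r3 r4 r5 r6 r7) = oct r7 (- r1) (- r2) (- r3) (- r4) (- r5) (- r6) r0.
Proof.
rewrite /oconj /oct zalphaE zbetaE zuE zvE.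
by rewrite -[- col3 _ _ _]scaleN1r -[- col3 r4 _ _]scaleN1r !col3Z !mulN1r.
Qed.

Lemma oone_oct : oone F = oct 1 0 0 0 0 0 0 1.
Proof. by rewrite /oone /oct; congr zorn; rewrite [LHS]col3P !mxE. Qed.

Lemma oform_oct r0 r1 r2 r3 r4 r5 r6 r7 s0 s1 s2 s3 s4 s5 s6 s7 :
  oform (oct r0 r1 r2 r3 r4 r5 r6 r7) (oct s0 s1 s2 s3 s4 s5 s6 s7) =
  r0 * s7 + r7 * s0 - (r1 * s4 + r4 * s1 + r2 * s5 + r5 * s2 + r3 * s6 + r6 * s3).
Proof. rewrite /oform octD !onorm_oct; ring. Qed.

End Coordinates.

Definition octE := (oone_oct, omul_oct, oconj_oct, onorm_oct, oform_oct, octD, octZ, octN).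
(* An identity between octonions is checked on the eight coordinates, where it
   becomes a polynomial identity. *)
Ltac oct_coord z :=
  let r0 := fresh "r" in let r1 := fresh "r" in let r2 := fresh "r" in
  let r3 := fresh "r" in let r4 := fresh "r" in let r5 := fresh "r" in
  let r6 := fresh "r" in let r7 := fresh "r" in
  have [r0 [r1 [r2 [r3 [r4 [r5 [r6 [r7 ->]]]]]]]] := octP z.
Ltac oct_ring := rewrite ?octE; try congr oct; ring.

(** * Identities of the Zorn algebra *)

Section Identities.
Variable F : fieldType.
Implicit Types (a b c d x y z : octonion F).

Lemma omulDl x y z : omul (x + y) z = omul x z + omul y z.
Proof. oct_coord x; oct_coord y; oct_coord z; oct_ring. Qed.
Lemma omulDr x y z : omul z (x + y) = omul z x + omul z y.
Proof. oct_coord x; oct_coord y; oct_coord z; oct_ring. Qed.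
Lemma omulZl k x z : omul (k *: x) z = k *: omul x z.
Proof. oct_coord x; oct_coord z; oct_ring. Qed.
Lemma omulZr k x z : omul z (k *: x) = k *: omul z x.
Proof. oct_coord x; oct_coord z; oct_ring. Qed.
Lemma omulNl x z : omul (- x) z = - omul x z.
Proof. by rewrite -scaleN1r omulZl scaleN1r. Qed.
Lemma omulNr x z : omul z (- x) = - omul z x.
Proof. by rewrite -scaleN1r omulZr scaleN1r. Qed.
Lemma omul1l z : omul (oone F) z = z.
Proof. oct_coord z; oct_ring. Qed.
Lemma omul1r z : omul z (oone F) = z.
Proof. oct_coord z; oct_ring. Qed.

Lemma onormM x y : onorm (omul x y) = onorm x * onorm y.
Proof. oct_coord x; oct_coord y; oct_ring. Qed.
Lemma onormZ k x : onorm (k *: x) = k ^+ 2 * onorm x.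
Proof. oct_coord x; oct_ring. Qed.
Lemma onormN x : onorm (- x) = onorm x.
Proof. by rewrite -scaleN1r onormZ sqrrN expr1n mul1r. Qed.
Lemma onorm1 : onorm (oone F) = 1.
Proof. oct_ring. Qed.
Lemma onorm_conj x : onorm (oconj x) = onorm x.
Proof. oct_coord x; oct_ring. Qed.

Lemma oconjK : involutive (@oconj F).
Proof. move=> z; oct_coord z; oct_ring. Qed.
Lemma oconjD x y : oconj (x + y) = oconj x + oconj y.
Proof. oct_coord x; oct_coord y; oct_ring. Qed.
Lemma oconjZ k x : oconj (k *: x) = k *: oconj x.
Proof. oct_coord x; oct_ring. Qed.
Lemma oconjM x y : oconj (omul x y) = omul (oconj y) (oconj x).
Proof. oct_coord x; oct_coord y; oct_ring. Qed.

Lemma oformDl x y z : oform (x + y) z = oform x z + oform y z.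
Proof. oct_coord x; oct_coord y; oct_coord z; oct_ring. Qed.
Lemma oformZl k x z : oform (k *: x) z = k * oform x z.
Proof. oct_coord x; oct_coord z; oct_ring. Qed.
Lemma oformC x y : oform x y = oform y x.
Proof. oct_coord x; oct_coord y; oct_ring. Qed.
Lemma oformDr x y z : oform z (x + y) = oform z x + oform z y.
Proof. by rewrite oformC oformDl !(oformC _ z). Qed.
Lemma oformZr k x z : oform z (k *: x) = k * oform z x.
Proof. by rewrite oformC oformZl oformC. Qed.
Lemma oformNr x z : oform z (- x) = - oform z x.
Proof. by rewrite -scaleN1r oformZr mulN1r. Qed.
Lemma oformxx x : oform x x = onorm x *+ 2.
Proof. oct_coord x; oct_ring. Qed.
Lemma oform_conj x y : oform (oconj x) (oconj y) = oform x y.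
Proof. oct_coord x; oct_coord y; oct_ring. Qed.
Lemma oformMl x y z : oform (omul x y) (omul x z) = onorm x * oform y z.
Proof. by rewrite /oform -omulDr !onormM !mulrBr. Qed.
Lemma oformMr x y z : oform (omul y x) (omul z x) = onorm x * oform y z.
Proof. rewrite /oform -omulDl !onormM; ring. Qed.

Lemma onormB x y : onorm (x - y) = onorm x + onorm y - oform x y.
Proof. by rewrite -(onormN y) -oformNr /oform; ring. Qed.

Definition imaginary a := oform a (oone F) = 0.

Lemma oconj_imaginary a : imaginary a -> oconj a = - a.
Proof.
rewrite /imaginary; oct_coord a; rewrite !octE !mulr1 !mulr0 !addr0 subr0 => /eqP.
by rewrite addr_eq0 => /eqP ->; rewrite opprK.
Qed.
Lemma flexible a z : omul (omul a z) a = omul a (omul z a).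
Proof. oct_coord a; oct_coord z; oct_ring. Qed.
Lemma left_alternative a z : omul a (omul a z) = omul (omul a a) z.
Proof. oct_coord a; oct_coord z; oct_ring. Qed.
Lemma omul_conjl a z : omul (oconj a) (omul a z) = onorm a *: z.
Proof. oct_coord a; oct_coord z; oct_ring. Qed.
Lemma omul_conjr a z : omul (omul z a) (oconj a) = onorm a *: z.
Proof. oct_coord a; oct_coord z; oct_ring. Qed.
Lemma omul_rconj a z : omul (omul z (oconj a)) a = onorm a *: z.
Proof. by rewrite -{2}[a]oconjK omul_conjr onorm_conj. Qed.
(** With B_a = L_a R_a this reads B_a(xy) = L_a(x) R_a(y): the source of all the
    triality relations below. *)
Lemma middle_moufang a x y : omul (omul a x) (omul y a) = omul (omul a (omul x y)) a.
Proof. oct_coord a; oct_coord x; oct_coord y; oct_ring. Qed.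
(** For n(c) = 1 the product (xc)(c^-1 y) of the isotope with unit 1 has left
    multiplications conjugate to the original ones: L_x becomes
    R_c^-1 L_x R_c. This is how c is detected from an element of SO(7). *)
Lemma isotope c x y : omul (omul x c) (omul (oconj c) y) = omul (omul x (omul y c)) (oconj c).
Proof. oct_coord c; oct_coord x; oct_coord y; oct_ring. Qed.
(** For anisotropic a, z |-> a (conj z) a is -n(a) times the reflection in a. *)
Lemma sandwich_conj a z : omul (omul a (oconj z)) a = oform z a *: a - onorm a *: z.
Proof. oct_coord a; oct_coord z; oct_ring. Qed.
(** When n(x) = 1 this is the Cayley-Hamilton equation, and shows that x is the
    square of a multiple of 1 + x as soon as 1 + x is not isotropic. *)
Lemma square_shift x :
  omul (oone F + x) (oone F + x) =
  (2%:R + oform x (oone F)) *: x + (1 - onorm x) *: oone F.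
Proof. oct_coord x; oct_ring. Qed.
Lemma onorm_shift x : onorm (oone F + x) = 1 + onorm x + oform x (oone F).
Proof. oct_coord x; oct_ring. Qed.

Lemma oct_inj r0 r1 r2 r3 r4 r5 r6 r7 s0 s1 s2 s3 s4 s5 s6 s7 :
  oct r0 r1 r2 r3 r4 r5 r6 r7 = oct s0 s1 s2 s3 s4 s5 s6 s7 :> octonion F ->
  [/\ r0 = s0, r1 = s1, r2 = s2 & r3 = s3] /\ [/\ r4 = s4, r5 = s5, r6 = s6 & r7 = s7].
Proof.
move=> E; split; split;
  have := congr1 (@zalpha F) E; have := congr1 (@zbeta F) E;
  have := congr1 (fun z : octonion F => zu z 0 0) E;
  have := congr1 (fun z : octonion F => zu z 1 0) E;
  have := congr1 (fun z : octonion F => zu z 2%:R 0) E;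
  have := congr1 (fun z : octonion F => zv z 0 0) E;
  have := congr1 (fun z : octonion F => zv z 1 0) E;
  have := congr1 (fun z : octonion F => zv z 2%:R 0) E;
  by rewrite /oct !zalphaE !zbetaE !zuE !zvE !mxE.
Qed.

Lemma commute_all_scalar c : (forall z, omul z c = omul c z) -> exists k, c = k *: oone F.
Proof.
oct_coord c => C; exists r; move: (C (oct 1 0 0 0 0 0 0 0)) (C (oct 0 1 0 0 0 0 0 0)).
rewrite !octE !(mul0r, mulr0, mul1r, mulr1, add0r, addr0, subr0, sub0r, oppr0).
by move=> /oct_inj[[_ -> -> ->] [<- <- <- _]] /oct_inj[[_ -> _ _] _].
Qed.

(** The three products u_i u_{i+1} of basis vectors already force c to be scalar. *)
Lemma right_nucleus_scalar c :
  (forall x y, omul (omul x y) c = omul x (omul y c)) -> exists k, c = k *: oone F.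
Proof.
oct_coord c => C; exists r.
move: (C (oct 0 1 0 0 0 0 0 0) (oct 0 0 1 0 0 0 0 0))
      (C (oct 0 0 1 0 0 0 0 0) (oct 0 0 0 1 0 0 0 0))
      (C (oct 0 0 0 1 0 0 0 0) (oct 0 1 0 0 0 0 0 0)).
rewrite !octE !(mul0r, mulr0, mul1r, mulr1, add0r, addr0, subr0, sub0r, oppr0, opprK).
move=> /oct_inj[[A1 A2 A3 A4] [A5 A6 A7 A8]] /oct_inj[[B1 B2 B3 B4] [B5 B6 B7 B8]].
move=> /oct_inj[[C1 C2 C3 C4] [C5 C6 C7 C8]].
by congr oct.
Qed.
End Identities.

(** * Linear operators on the octonions *)

(** Both sides are the determinant of the block matrix (1, v; w, 1), eliminated
    from either corner. *)
Lemma det_rank1 (R : comNzRingType) n (w : 'cV[R]_n) (v : 'rV[R]_n) :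
  \det (1%:M - w *m v) = 1 - (v *m w) 0 0.
Proof.
have E1 : block_mx 1%:M v w 1%:M =
    block_mx (1%:M : 'M[R]_1) 0 w 1%:M *m block_mx 1%:M v 0 (1%:M - w *m v).
  by rewrite mulmx_block !(mul1mx, mul0mx, mulmx1, mulmx0, addr0) subrKC.
have E2 : block_mx 1%:M v w 1%:M =
    block_mx (1%:M - v *m w : 'M[R]_1) v 0 1%:M *m block_mx 1%:M 0 w 1%:M.
  by rewrite mulmx_block !(mul1mx, mul0mx, mulmx1, mulmx0, addr0, add0r) subrK.
have := congr1 determinant E1; rewrite E2 !det_mulmx.
rewrite !det_ublock !det_lblock !det1 !(mul1r, mulr1) det_mx11 => <-.
by rewrite !mxE.
Qed.

Section Operators.
Variable F : fieldType.
Implicit Types (a b c d x y z : octonion F) (A B h : operator F).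

Lemma operatorP A B : (forall z, A *m z = B *m z) -> A = B.
Proof.
move=> AB; apply/matrixP => i j; have := AB (delta_mx j 0).
by rewrite -!colE => /colP/(_ i); rewrite !mxE.
Qed.

Lemma mx_of_funE (g : octonion F -> octonion F) :
  (forall k x y, g (k *: x + y) = k *: g x + g y) -> forall z, mx_of_fun g *m z = g z.
Proof.
move=> lin z; have g0 : g 0 = 0.
  by have := lin (-1) 0 0; rewrite !scaleN1r oppr0 addr0 addNr.
have gsum (I : Type) (r : seq I) (c : I -> F) (e : I -> octonion F) :
    g (\sum_(i <- r) c i *: e i) = \sum_(i <- r) c i *: g (e i).
  by elim: r => [|i r IH]; rewrite ?big_nil // !big_cons lin IH.
have {2}-> : z = \sum_i z i 0 *: delta_mx i 0.
  by rewrite {1}[z]matrix_sum_delta; apply: eq_bigr => i _; rewrite big_ord1.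
rewrite gsum; apply/colP => i; rewrite !mxE summxE.
by apply: eq_bigr => j _; rewrite !mxE mulrC.
Qed.

Definition kappa : operator F := mx_of_fun (@oconj F).

Lemma Lop_mul x z : Lop x *m z = omul x z.
Proof. by apply: mx_of_funE => k y t; rewrite omulDr omulZr. Qed.
Lemma Rop_mul x z : Rop x *m z = omul z x.
Proof. by apply: mx_of_funE => k y t; rewrite omulDl omulZl. Qed.
Lemma kappa_mul z : kappa *m z = oconj z.
Proof. by apply: mx_of_funE => k y t; rewrite oconjD oconjZ. Qed.

Definition opE := (kappa_mul, Lop_mul, Rop_mul).

Lemma kappaK : kappa *m kappa = 1%:M.
Proof. by apply: operatorP => z; rewrite -mulmxA !opE oconjK mul1mx. Qed.

Lemma kappa_Rop a : kappa *m Rop a *m kappa = Lop (oconj a).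
Proof. by apply: operatorP => z; rewrite -!mulmxA !opE oconjM oconjK. Qed.

Lemma kappa_Lop a : kappa *m Lop a *m kappa = Rop (oconj a).
Proof. by apply: operatorP => z; rewrite -!mulmxA !opE oconjM oconjK. Qed.

Lemma Lop_conj a : onorm a = 1 -> Lop (oconj a) *m Lop a = 1%:M.
Proof. by move=> n1; apply: operatorP => z; rewrite -mulmxA !opE omul_conjl n1 scale1r mul1mx. Qed.
Lemma Rop_conj a : onorm a = 1 -> Rop (oconj a) *m Rop a = 1%:M.
Proof. by move=> n1; apply: operatorP => z; rewrite -mulmxA !opE omul_conjr n1 scale1r mul1mx. Qed.

Lemma invmx_left A B : B *m A = 1%:M -> invmx A = B.
Proof.
move=> BA; have [_ uA] := mulmx1_unit BA.
by rewrite -[LHS]mul1mx -BA mulmxK.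
Qed.

Lemma invmx_Lop a : onorm a = 1 -> invmx (Lop a) = Lop (oconj a).
Proof. by move/Lop_conj/invmx_left. Qed.
Lemma invmx_Rop a : onorm a = 1 -> invmx (Rop a) = Rop (oconj a).
Proof. by move/Rop_conj/invmx_left. Qed.
Lemma Pop_sandwich a : onorm a = 1 -> Pop a = Lop (oconj a) *m Rop (oconj a).
Proof. by move=> n1; rewrite /Pop invmx_Lop // invmx_Rop. Qed.

Definition isometric h := forall x y, oform (h *m x) (h *m y) = oform x y.

Lemma isometricM A B : isometric A -> isometric B -> isometric (A *m B).
Proof. by move=> oA oB x y; rewrite -!mulmxA oA oB. Qed.

Lemma isometricN A : isometric A -> isometric (- A).
Proof. by move=> oA x y; rewrite !mulNmx oformNr oformC oformNr opprK oformC oA. Qed.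

Lemma isometric_kappa : isometric kappa.
Proof. by move=> x y; rewrite !opE oform_conj. Qed.
Lemma isometric_Lop a : onorm a = 1 -> isometric (Lop a).
Proof. by move=> n1 x y; rewrite !opE oformMl n1 mul1r. Qed.
Lemma isometric_Rop a : onorm a = 1 -> isometric (Rop a).
Proof. by move=> n1 x y; rewrite !opE oformMr n1 mul1r. Qed.

(** The Gram matrix of [oform] in the coordinate basis, described as the signed
    permutation of coordinates that it performs. *)
Definition gramfun z : octonion F :=
  zorn (zbeta z) (- zv z) (- zu z) (zalpha z).
Lemma gramfun_oct r0 r1 r2 r3 r4 r5 r6 r7 :
  gramfun (oct r0 r1 r2 r3 r4 r5 r6 r7) = oct r7 (- r4) (- r5) (- r6) (- r1) (- r2) (- r3) r0.
Proof.
rewrite /gramfun /oct zalphaE zbetaE zuE zvE.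
by rewrite -[- col3 _ _ _]scaleN1r -[- col3 r1 _ _]scaleN1r !col3Z !mulN1r.
Qed.
Definition gram : operator F := mx_of_fun gramfun.
Lemma gram_mul z : gram *m z = gramfun z.
Proof.
apply: mx_of_funE => k x y; oct_coord x; oct_coord y.
by rewrite !(octE, gramfun_oct); congr oct; ring.
Qed.
Lemma gramK : gram *m gram = 1%:M.
Proof.
apply: operatorP => z; rewrite -mulmxA !gram_mul mul1mx.
by oct_coord z; rewrite !gramfun_oct !opprK.
Qed.

Lemma dot_oct r0 r1 r2 r3 r4 r5 r6 r7 s0 s1 s2 s3 s4 s5 s6 s7 :
  (oct r0 r1 r2 r3 r4 r5 r6 r7)^T *m oct s0 s1 s2 s3 s4 s5 s6 s7 =
  (r0 * s0 + (r1 * s1 + r2 * s2 + r3 * s3) + (r4 * s4 + r5 * s5 + r6 * s6) + r7 * s7)%:M :> 'M[F]_1.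
Proof.
have dotE (u v : 'cV[F]_3) : u^T *m v = (dot u v)%:M.
  apply/matrixP => i j; rewrite !ord1 !mxE eqxx mulr1n /dot.
  by apply: eq_bigr => k _; rewrite !mxE.
rewrite /oct /zorn !tr_col_mx !mul_row_col !dotE !dot3 !tr_scalar_mx -!scalar_mxM.
by rewrite -!raddfD /= !addrA.
Qed.

Lemma oform_gram x y : x^T *m gram *m y = (oform x y)%:M.
Proof.
rewrite -mulmxA gram_mul; oct_coord x; oct_coord y.
rewrite gramfun_oct dot_oct octE; congr (_%:M); ring.
Qed.

Lemma isometric_gram h : isometric h -> h^T *m gram *m h = gram.
Proof.
move=> oh; apply/matrixP => i j.
have E A : ((delta_mx i 0 : octonion F)^T *m A *m (delta_mx j 0 : octonion F)) 0 0 = A i j.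
  by rewrite trmx_delta -rowE -colE !mxE.
rewrite -[LHS]E -[RHS]E; congr (fun_of_matrix _ 0 0).
by rewrite oform_gram -oh -oform_gram trmx_mul !mulmxA.
Qed.

(** The Gram matrix is invertible, being an involution. *)
Lemma isometric_det h : isometric h -> \det h ^+ 2 = 1.
Proof.
move/isometric_gram/(congr1 (fun A => \det A)); rewrite !det_mulmx det_tr => E.
have g0 : \det gram != 0.
  apply/eqP => g0; have := congr1 (fun A => \det A) gramK.
  by rewrite det_mulmx g0 mul0r det1 => /esym/eqP; rewrite oner_eq0.
by apply: (mulIf g0); rewrite mul1r -[RHS]E; ring.
Qed.

Lemma isometric_unit h : isometric h -> h \in unitmx.
Proof.
move/isometric_det => d; rewrite unitmxE unitfE.
by apply: contra_eq_neq d => ->; rewrite expr0n /= eq_sym oner_eq0.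
Qed.

Lemma isometricV h : isometric h -> isometric (invmx h).
Proof.
move=> oh x y; have uh := isometric_unit oh.
by rewrite -oh !(mulKVmx uh).
Qed.

Lemma isometric_norm h x : (2%:R != 0 :> F) -> isometric h -> onorm (h *m x) = onorm x.
Proof.
move=> F2 oh; have := oh x x; rewrite !oformxx -[LHS]mulr_natl -[RHS]mulr_natl.
by move/(mulfI F2).
Qed.

End Operators.

(** * SO(8) and PSO(8) *)

Section SpecialOrthogonal.
Variable F : closedFieldType.
Hypothesis F2 : 2%:R != 0 :> F.
Implicit Types (a b c d x y z : octonion F) (A B h : operator F).

Lemma sqrt_exists (k : F) : exists s, s ^+ 2 = k.
Proof.
have [s] := solve_monicpoly (fun i : nat => if i == 0 then k else 0) (isT : (0 < 2)%N).
rewrite !big_ord_recr big_ord0 /= => sE; exists s.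
by rewrite sE !(mul0r, add0r, addr0) expr0 mulr1.
Qed.

Lemma normalize a : onorm a != 0 -> exists2 s, s != 0 & onorm (s *: a) = 1.
Proof.
move=> na; have [s s2] := sqrt_exists (onorm a)^-1.
exists s; last by rewrite onormZ s2 mulVf.
by apply: contraNneq na => s0; rewrite -invr_eq0 -s2 s0 expr0n.
Qed.

Lemma det_opp_operator A : \det (- A) = \det A.
Proof. by rewrite -scaleN1r detZ -[X in X * _]signr_odd expr0 mul1r. Qed.

(** Minus conjugation is the reflection in 1. *)
Lemma det_kappa : \det (kappa F) = -1.
Proof.
rewrite -det_opp_operator.
have -> : - kappa F = 1%:M - oone F *m ((oone F)^T *m gram F).
  apply: operatorP => z; rewrite mulNmx mulmxBl mul1mx kappa_mul -mulmxA oform_gram.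
  rewrite mul_mx_scalar oformC; oct_coord z; oct_ring.
rewrite det_rank1 oform_gram oformxx onorm1 mxE eqxx mulr1n; ring.
Qed.

Lemma SO8M A B : SO8 A -> SO8 B -> SO8 (A *m B).
Proof. by move=> [dA oA] [dB oB]; split; [rewrite det_mulmx dA dB mul1r | exact: isometricM]. Qed.
Lemma SO8V A : SO8 A -> SO8 (invmx A).
Proof. by move=> [dA oA]; split; [rewrite det_inv dA invr1 | exact: isometricV]. Qed.
Lemma SO8_unit A : SO8 A -> A \in unitmx.
Proof. by move=> [_ /isometric_unit]. Qed.
Lemma SO8_kappa A : SO8 A -> SO8 (kappa F *m A *m kappa F).
Proof.
move=> [dA oA]; split; first by rewrite !det_mulmx dA mulr1 det_kappa mulrNN mulr1.
by apply: isometricM; [apply: isometricM|]; try exact: isometric_kappa.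
Qed.

(** Either 1 + x or 1 - x is anisotropic, since n(1 + x) + n(1 - x) = 4; whichever
    it is, normalized, is a square root of x or of -x. *)
Lemma unit_norm_square x : onorm x = 1 ->
  exists2 y, onorm y = 1 & x = omul y y \/ x = - omul y y.
Proof.
move=> n1.
have main w : onorm w = 1 -> onorm (oone F + w) != 0 ->
    exists2 y, onorm y = 1 & w = omul y y.
  move=> nw ns; have [s s0 sn] := normalize ns.
  exists (s *: (oone F + w)) => //.
  rewrite omulZl omulZr square_shift nw subrr scale0r addr0 !scalerA.
  move: sn; rewrite onormZ onorm_shift nw => sn.
  by rewrite -[LHS]scale1r; congr (_ *: _); rewrite -[LHS]sn; ring.
have [E|/(main _ n1)[y ny ->]] := eqVneq (onorm (oone F + x)) 0; last by exists y; [|left].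
have nN : onorm (oone F + - x) != 0.
  have -> : onorm (oone F + - x) = 2%:R + 2%:R * onorm x - onorm (oone F + x).
    by rewrite !onorm_shift onormN (oformC (- x)) oformNr (oformC x); ring.
  have -> : 2%:R + 2%:R * onorm x - onorm (oone F + x) = 2%:R * 2%:R by rewrite E n1; ring.
  exact: mulf_neq0.
have [y ny E'] := main (- x) (etrans (onormN x) n1) nN.
by exists y => //; right; rewrite -E' opprK.
Qed.

(** L_{yy} = L_y L_y has determinant 1 because det L_y is 1 or -1, L_y being isometric;
    and L_{-x} = -L_x has the determinant of L_x, the dimension being even. *)
Lemma det_Lop x : onorm x = 1 -> \det (Lop x) = 1.
Proof.
move=> /unit_norm_square[y ny xE].
have sq : \det (Lop (omul y y)) = 1.
  have -> : Lop (omul y y) = Lop y *m Lop y.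
    by apply: operatorP => z; rewrite -mulmxA !opE left_alternative.
  by rewrite det_mulmx -expr2; exact/isometric_det/isometric_Lop.
case: xE => -> //; rewrite -sq -[RHS]det_opp_operator; congr (\det _).
by apply: operatorP => z; rewrite mulNmx !opE omulNl.
Qed.

Lemma SO8_Lop x : onorm x = 1 -> SO8 (Lop x).
Proof. by move=> n1; split; [exact: det_Lop | exact: isometric_Lop]. Qed.
Lemma SO8_Rop x : onorm x = 1 -> SO8 (Rop x).
Proof.
move=> n1; rewrite -[x]oconjK -kappa_Lop.
by apply/SO8_kappa/SO8_Lop; rewrite onorm_conj.
Qed.

Lemma pclassE A : pclass A = [set A; - A]%classic.
Proof.
apply/seteqP; split=> [_ [B [] -> <-]|_ [] ->] /=.
- by rewrite mulmx1; left.
- by rewrite mulmxN mulmx1; right.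
- by exists 1%:M; [left | rewrite mulmx1].
- by exists (- 1%:M); [right | rewrite mulmxN mulmx1].
Qed.

Lemma pclass_mem A : pclass A A.
Proof. by rewrite pclassE; left. Qed.

Lemma pclass_eq A B : pclass A = pclass B <-> A = B \/ A = - B.
Proof.
split=> [E|[->//|->]]; first by have := pclass_mem A; rewrite E pclassE => -[]; [left|right].
by rewrite !pclassE opprK classical_sets.setUC.
Qed.

Lemma pclassN A : pclass (- A) = pclass A.
Proof. by apply/pclass_eq; right. Qed.

Lemma points_PSO8 X : points (PSO8 F) X <-> exists2 A, SO8 A & X = pclass A.
Proof.
split=> [[A [_ sA] <-]|[A sA ->]]; first by exists A.
by exists A.
Qed.

Lemma pclassM A B : coset_mul (pclass A) (pclass B) = pclass (A *m B).
Proof.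
rewrite !pclassE; apply/seteqP; split=> [_ [C [] -> [D [] -> <-]]|_ [] ->] /=.
- by left.
- by right; rewrite mulmxN.
- by right; rewrite mulNmx.
- by left; rewrite mulNmx mulmxN opprK.
- by exists A; [left | exists B; [left|]].
- by exists (- A); [right | exists B; [left | rewrite mulNmx]].
Qed.

Lemma pclassV A : SO8 A -> coset_inv (pclass A) = pclass (invmx A).
Proof.
move=> /SO8_unit uA.
have EN : invmx (- A) = - invmx A.
  by apply: invmx_left; rewrite mulNmx mulmxN opprK mulVmx.
rewrite !pclassE; apply/seteqP; split=> [_ [C [] -> <-]|_ [] ->] /=.
- by left.
- by right.
- by exists A; [left|].
- by exists (- A); [right|].
Qed.
End SpecialOrthogonal.

(** * Triples of operators in triality *)

Section Triality.
Variable F : closedFieldType.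
Hypothesis F2 : 2%:R != 0 :> F.
Variable rho : set (operator F) -> set (operator F).
Hypothesis Hrho : is_triality rho.
Implicit Types (a b c d x y z : octonion F) (A B h k : operator F).

Local Notation K := (kappa F).

Lemma kappa_conjM A B : K *m (A *m B) *m K = (K *m A *m K) *m (K *m B *m K).
Proof. by rewrite !mulmxA -(mulmxA _ K K) kappaK mulmx1. Qed.

Lemma rho_point A : SO8 A -> points (PSO8 F) (rho (pclass A)).
Proof.
move=> sA; have [Hf _ _] := triality_bij Hrho.
by apply: Hf; apply/points_PSO8; exists A.
Qed.

Lemma rho_mul A B : SO8 A -> SO8 B ->
  rho (pclass (A *m B)) = coset_mul (rho (pclass A)) (rho (pclass B)).
Proof.
move=> sA sB; rewrite -pclassM (triality_mul Hrho) //.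
  by apply/points_PSO8; exists A.
by apply/points_PSO8; exists B.
Qed.

Lemma rho2_mul A B : SO8 A -> SO8 B ->
  rho (rho (pclass (A *m B))) = coset_mul (rho (rho (pclass A))) (rho (rho (pclass B))).
Proof. by move=> sA sB; rewrite rho_mul // (triality_mul Hrho) //; exact: rho_point. Qed.

(** The triality triples: h(xy) = h1(x) h2(y). The images of h under rho and its
    square are [h2] and [h1] up to conjugation by [kappa], which exchanges left and
    right multiplications. *)
Record related h h1 h2 : Prop := Related {
  related_SO8 : SO8 h;
  related_SO8l : SO8 h1;
  related_SO8r : SO8 h2;
  related_mul : forall x y, h *m omul x y = omul (h1 *m x) (h2 *m y);
  related_rho : rho (pclass h) = pclass (K *m h2 *m K);
  related_rho2 : rho (rho (pclass h)) = pclass (K *m h1 *m K) }.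

Lemma relatedM h h1 h2 k k1 k2 :
  related h h1 h2 -> related k k1 k2 -> related (h *m k) (h1 *m k1) (h2 *m k2).
Proof.
move=> [sh sh1 sh2 Eh rh rrh] [sk sk1 sk2 Ek rk rrk].
split; try exact: SO8M.
- by move=> x y; rewrite -!mulmxA Ek Eh.
- by rewrite rho_mul // rh rk pclassM kappa_conjM.
- by rewrite rho2_mul // rrh rrk pclassM kappa_conjM.
Qed.

Definition bimul a := Lop a *m Rop a.

Lemma bimulE a z : bimul a *m z = omul (omul a z) a.
Proof. by rewrite -mulmxA !opE flexible. Qed.

(** On B_a = L_a R_a the prescribed values give rho(B_a) = R_a P_a, which is the left
    multiplication by conj a, and then rho^2(B_a) is the right multiplication. *)
Lemma related_bimul a : onorm a = 1 -> related (bimul a) (Lop a) (Rop a).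
Proof.
move=> n1; have sL := SO8_Lop F2 n1; have sR := SO8_Rop F2 n1.
have n1' : onorm (oconj a) = 1 by rewrite onorm_conj.
have r1 : rho (pclass (bimul a)) = pclass (Lop (oconj a)).
  rewrite rho_mul // (triality_L Hrho) // (triality_R Hrho) // pclassM Pop_sandwich //.
  congr pclass; apply: operatorP => z.
  by rewrite -!mulmxA !opE -flexible omul_rconj n1 scale1r.
split => //.
- exact: SO8M.
- by move=> x y; rewrite bimulE Lop_mul Rop_mul middle_moufang.
- by rewrite kappa_Rop.
- by rewrite r1 (triality_L Hrho) // kappa_Lop.
Qed.

Lemma related1 : related 1%:M 1%:M 1%:M.
Proof.
have L1 : Lop (oone F) = 1%:M by apply: operatorP => z; rewrite Lop_mul omul1l mul1mx.
have R1 : Rop (oone F) = 1%:M by apply: operatorP => z; rewrite Rop_mul omul1r mul1mx.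
by have := related_bimul (onorm1 F); rewrite /bimul L1 R1 mulmx1.
Qed.

(** * Generation of SO(7) by reflections *)
Definition refl a : operator F := - (bimul a *m K).

Lemma refl_mul a z : onorm a = 1 -> refl a *m z = z - oform z a *: a.
Proof.
move=> n1; rewrite mulNmx -mulmxA kappa_mul bimulE sandwich_conj n1 scale1r.
by rewrite opprB.
Qed.

Lemma reflK a : onorm a = 1 -> refl a *m refl a = 1%:M.
Proof.
move=> n1; apply: operatorP => z; rewrite -mulmxA !refl_mul // mul1mx.
have -> : oform (z - oform z a *: a) a = - oform z a.
  by rewrite -scaleNr oformDl oformZl oformxx n1; ring.
by rewrite scaleNr opprK subrK.
Qed.

Lemma isometric_refl a : onorm a = 1 -> isometric (refl a).
Proof.
move=> n1; apply/isometricN/isometricM/isometric_kappa.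
by apply: isometricM; [exact: isometric_Lop | exact: isometric_Rop].
Qed.

Lemma det_refl a : onorm a = 1 -> \det (refl a) = -1.
Proof.
move=> n1; have [[d _] _ _ _ _ _] := related_bimul n1.
by rewrite det_opp_operator det_mulmx d det_kappa // mul1r.
Qed.

Definition imaginary_unit a := imaginary a /\ onorm a = 1.

(** Conjugating by [kappa] turns B_b into B_{conj b} = B_{-b} = B_b, b being
    imaginary. *)
Lemma refl2 a b : imaginary_unit a -> imaginary_unit b ->
  refl a *m refl b = bimul a *m bimul b.
Proof.
move=> [_ na] [b0 nb]; rewrite /refl mulNmx mulmxN opprK -!mulmxA; congr (_ *m _).
apply: operatorP => z; rewrite -!mulmxA !(opE, bimulE) !oconjM oconjK.
by rewrite (oconj_imaginary b0) !(omulNl, omulNr) opprK flexible.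
Qed.

(** Products of reflections in imaginary units, by parity of their length: an even
    product lies in a triality triple, an odd one is a reflection away from it. *)
Definition reflection_product h :=
  (exists h1 h2, related h h1 h2) \/
  (exists a k k1 k2, [/\ imaginary_unit a, related k k1 k2 & h = refl a *m k]).

Lemma reflection_product_refl a h :
  imaginary_unit a -> reflection_product h -> reflection_product (refl a *m h).
Proof.
move=> ia [[h1 [h2 rh]]|[b [k [k1 [k2 [ib rk ->]]]]]].
  by right; exists a, h, h1, h2.
left; rewrite mulmxA refl2 //.
by do 2!eexists; apply: relatedM rk; apply: relatedM; apply: related_bimul; case: ia ib => _ ? [].
Qed.

Lemma refl_swap x y s : onorm x = onorm y -> onorm (s *: (x - y)) = 1 ->
  refl (s *: (x - y)) *m y = x.
Proof.
move=> nxy n1; rewrite refl_mul // oformZr scalerA.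
have -> : s * oform y (x - y) * s = -1.
  rewrite -[in RHS]n1 onormZ.
  have -> : onorm (x - y) = - oform y (x - y).
    by rewrite onormB oformDr oformNr oformxx nxy (oformC x); ring.
  by ring.
by rewrite scaleN1r opprK addrC subrK.
Qed.

Lemma refl_fix a z : onorm a = 1 -> oform z a = 0 -> refl a *m z = z.
Proof. by move=> n1 za; rewrite refl_mul // za scale0r subr0. Qed.

(** The reflection exchanging x and y fixes whatever is orthogonal to both; in
    particular it is a reflection in an imaginary vector once 1 is among the fixed
    vectors. *)
Lemma exists_swap (es : seq (octonion F)) x y :
  oone F \in es -> {in es, forall e, oform e x = 0 /\ oform e y = 0} ->
  onorm x = onorm y -> onorm (x - y) != 0 ->
  exists a, [/\ imaginary_unit a, refl a *m y = x & {in es, forall e, refl a *m e = e}].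
Proof.
move=> e1 orth nxy /normalize[s s0 n1].
have orth' e : e \in es -> oform e (s *: (x - y)) = 0.
  by move=> /orth[ex ey]; rewrite oformZr oformDr oformNr ex ey subrr mulr0.
exists (s *: (x - y)); split; last by move=> e /orth'/(refl_fix n1).
  by split=> //; rewrite /imaginary oformC; exact: orth'.
exact: refl_swap.
Qed.

(** A weak Cartan-Dieudonne theorem, with no bound on the number of reflections. The
    isometry h is corrected until it fixes one more vector f of an orthogonal basis.
    As n(f - hf) + n(f + hf) = 4 n(f) is not 0, either one reflection carries hf to f,
    or one carries hf to -f and the reflection in f finishes. *)
Lemma cartan_dieudonne (fs es : seq (octonion F)) h :
  oone F \in es ->
  pairwise (fun x y => oform x y == 0) (es ++ fs) ->
  {in fs, forall f, onorm f != 0} ->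
  (forall k, {in es ++ fs, forall f, k *m f = f} -> k = 1%:M) ->
  isometric h -> {in es, forall e, h *m e = e} -> reflection_product h.
Proof.
elim: fs es h => [|f fs IH] es h e1 orth nfs total oh fix_es.
  left; exists 1%:M, 1%:M; rewrite (total h) ?cats0 //; exact: related1.
have nh x : onorm (h *m x) = onorm x by exact: isometric_norm.
have orthf : {in es, forall e, oform e f = 0}.
  move=> e ee; move: orth; rewrite pairwise_cat => /and3P[/allrelP/(_ e f ee) + _ _].
  by rewrite mem_head => /(_ isT)/eqP.
have orthhf : {in es, forall e, oform e (h *m f) = 0}.
  by move=> e ee; rewrite -(fix_es e ee) oh orthf.
have step k : isometric k -> k *m f = f -> {in es, forall e, k *m e = e} ->
    reflection_product k.
  move=> ok kf kes; apply: (IH (rcons es f)); rewrite ?cat_rcons //.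
  - by rewrite mem_rcons inE e1 orbT.
  - by move=> g gfs; apply: nfs; rewrite inE gfs orbT.
  - by move=> e; rewrite mem_rcons inE => /predU1P[->|/kes].
have undo a k : imaginary_unit a -> reflection_product (refl a *m k) -> reflection_product k.
  move=> ia /(reflection_product_refl ia); case: ia => _ na.
  by rewrite mulmxA reflK // mul1mx.
have [E|E] := eqVneq (onorm (f - h *m f)) 0; last first.
  have [|a [ia ahf aes]] := exists_swap e1 _ (esym (nh f)) E.
    by move=> e ee; rewrite orthf // orthhf.
  apply: (undo a) => //; apply: step.
  - by apply: isometricM oh; case: ia => _ /isometric_refl.
  - by rewrite -mulmxA.
  - by move=> e ee; rewrite -mulmxA fix_es // aes.
have nf : onorm f != 0 by apply: nfs; rewrite mem_head.
have F4 : 4%:R != 0 :> F.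
  by rewrite (_ : 4%:R = 2%:R * 2%:R) ?mulf_neq0 //; ring.
have E' : onorm (f - - (h *m f)) != 0.
  have -> : onorm (f - - (h *m f)) = 4%:R * onorm f - onorm (f - h *m f).
    by rewrite !onormB onormN oformNr nh; ring.
  by rewrite E subr0 mulf_neq0.
have [||a [ia ahf aes]] := exists_swap e1 _ _ E'.
- by move=> e ee; rewrite oformNr orthf // orthhf // oppr0.
- by rewrite onormN nh.
have n2f : onorm (f - - f) != 0.
  by rewrite (_ : onorm _ = 4%:R * onorm f) ?mulf_neq0 // onormB onormN oformNr oformxx; ring.
have [|b [ib bf bes]] := exists_swap e1 _ (esym (onormN f)) n2f.
  by move=> e ee; rewrite oformNr orthf // oppr0.
apply: (undo a) => //; apply: (undo b) => //; apply: step.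
- apply: isometricM; first by case: ib => _ /isometric_refl.
  by apply: isometricM oh; case: ia => _ /isometric_refl.
- have E2 : refl a *m h *m f = - f by rewrite -[in RHS]ahf mulmxN opprK mulmxA.
  by rewrite -mulmxA E2.
- by move=> e ee; rewrite -!mulmxA fix_es // aes // bes.
Qed.

(** Together with 1, an orthogonal basis of anisotropic vectors. *)
Definition obasis : seq (octonion F) :=
  [:: oct 1 0 0 0 0 0 0 (-1); oct 0 1 0 0 1 0 0 0; oct 0 0 1 0 0 1 0 0; oct 0 0 0 1 0 0 1 0;
      oct 0 1 0 0 (-1) 0 0 0; oct 0 0 1 0 0 (-1) 0 0; oct 0 0 0 1 0 0 (-1) 0].

Lemma obasis_orthogonal : pairwise (fun x y => oform x y == 0) (oone F :: obasis).
Proof.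
rewrite /= !octE.
by rewrite !(mul0r, mulr0, mul1r, mulr1, addr0, add0r, subrr, oppr0, addrN, addNr, eqxx).
Qed.

Lemma obasis_nonisotropic : {in obasis, forall f : octonion F, onorm f != 0}.
Proof.
apply/allP; rewrite /= !octE !(mul0r, mulr0, mul1r, mulr1, addr0, add0r, sub0r, subr0, opprK).
by rewrite oppr_eq0 oner_eq0.
Qed.

Lemma obasis_total k : {in oone F :: obasis, forall f, k *m f = f} -> k = 1%:M.
Proof.
move=> fix_k; apply: operatorP => z; rewrite mul1mx; oct_coord z.
have -> : oct r r0 r1 r2 r3 r4 r5 r6 = 
   ((r + r6) / 2%:R) *: oone F + \sum_(i < 7) [:: (r - r6) / 2%:R; (r0 + r3) / 2%:R;
   (r1 + r4) / 2%:R; (r2 + r5) / 2%:R; (r0 - r3) / 2%:R; (r1 - r4) / 2%:R; (r2 - r5) / 2%:R]`_i *: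
   obasis`_i.
  by rewrite !big_ord_recr big_ord0 /= add0r !octE; congr oct; field.
rewrite mulmxDr mulmx_sumr -scalemxAr fix_k ?mem_head //; congr (_ + _).
apply: eq_bigr => i _; rewrite -scalemxAr fix_k // inE.
by apply/orP; right; apply: mem_nth.
Qed.

(** A reflection has determinant -1, so the odd products are excluded. *)
Lemma SO7_related h : SO7 h -> exists h1 h2, related h h1 h2.
Proof.
move=> [[dh oh] h1].
have [] // := @cartan_dieudonne obasis [:: oone F] h.
- exact: mem_head.
- exact: obasis_orthogonal.
- exact: obasis_nonisotropic.
- exact: obasis_total.
- by move=> e; rewrite inE => /eqP->.
move=> [a [k [k1 [k2 [[_ na] [[dk _] _ _ _ _ _] E]]]]]; move: dh.
rewrite E det_mulmx dk det_refl // mulr1 => /eqP.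
by rewrite eq_sym -subr_eq0 opprK -mulr2n (negPf F2).
Qed.
End Triality.

(** * Formula for f and its fibres *)

Section Parametrization.
Variable F : closedFieldType.
Hypothesis F2 : 2%:R != 0 :> F.
Variable rho : set (operator F) -> set (operator F).
Hypothesis Hrho : is_triality rho.
Implicit Types (a b c d x y z : octonion F) (A B h k g : operator F).

Local Notation K := (kappa F).
Local Notation related := (related rho).

Lemma SO7M h k : SO7 h -> SO7 k -> SO7 (h *m k).
Proof. by move=> [sh h1] [sk k1]; split; [exact: SO8M | rewrite -mulmxA k1]. Qed.

Lemma SO7V h : SO7 h -> SO7 (invmx h).
Proof.
move=> [sh h1]; split; first exact: SO8V.
by rewrite -{1}h1 mulKmx //; exact: SO8_unit sh.
Qed.

Lemma invmxM A B : A \in unitmx -> B \in unitmx -> invmx (A *m B) = invmx B *m invmx A.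
Proof. by move=> uA uB; apply: invmx_left; rewrite mulmxA mulmxKV // mulVmx. Qed.

Lemma invmx_kappa A : A \in unitmx -> invmx (K *m A *m K) = K *m invmx A *m K.
Proof.
by move=> uA; apply: invmx_left; rewrite -kappa_conjM mulVmx // mulmx1 kappaK.
Qed.

Lemma fmap_related h h1 h2 : related h h1 h2 ->
  fmap rho h = pclass (K *m (h1 *m invmx h2) *m K).
Proof.
move=> [sh sh1 sh2 _ r1 r2]; rewrite /fmap r2 r1 pclassV; last exact: SO8_kappa.
by rewrite pclassM invmx_kappa ?kappa_conjM //; exact: SO8_unit sh2.
Qed.

(** Since h fixes 1, setting y = 1 or x = 1 in h(xy) = h1(x) h2(y) expresses h1 and
    h2 through h and the single octonion c = h1(1). *)
Lemma related_unit h h1 h2 : related h h1 h2 -> h *m oone F = oone F ->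
  let c := h1 *m oone F in
  [/\ onorm c = 1, h1 = Rop c *m h & h2 = Lop (oconj c) *m h].
Proof.
move=> [_ [_ o1] _ E _ _] e c.
have nc : onorm c = 1 by rewrite isometric_norm // onorm1.
have cd : omul c (h2 *m oone F) = oone F by rewrite -E omul1l.
have dE : h2 *m oone F = oconj c.
  by rewrite -[LHS]scale1r -nc -omul_conjl cd omul1r.
split=> //; apply: operatorP => z; rewrite -mulmxA !opE.
  by rewrite -[z in h *m z]omul1r E dE omul_rconj nc scale1r.
by rewrite -[z in h *m z]omul1l E omul_conjl nc scale1r.
Qed.

(** f(h) is the class of kappa h1 h2^-1 kappa = kappa R_c L_c kappa, and conjugation
    by kappa makes this the product of the two multiplications by conj c = c^-1. *)
Lemma fmap_Pbar h h1 h2 : related h h1 h2 -> h *m oone F = oone F ->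
  fmap rho h = Pbar (h1 *m oone F).
Proof.
move=> R h1e; have [nc E1 E2] := related_unit R h1e.
have uh : h \in unitmx by case: R => /SO8_unit.
set c := h1 *m oone F in nc E1 E2 *.
rewrite (fmap_related R) /Pbar Pop_sandwich //; congr pclass.
have uL : Lop (oconj c) \in unitmx by apply/SO8_unit/SO8_Lop; rewrite ?onorm_conj.
rewrite E1 E2 invmxM // invmx_Lop ?onorm_conj // oconjK !mulmxA mulmxK //.
apply: operatorP => z; by rewrite -!mulmxA !opE !oconjM oconjK.
Qed.

Lemma SO7_twist h : SO7 h ->
  exists2 c, onorm c = 1 & related h (Rop c *m h) (Lop (oconj c) *m h).
Proof.
move=> sh; have [h1 [h2 R]] := SO7_related F2 Hrho sh.
by have [nc E1 E2] := related_unit R sh.2; exists (h1 *m oone F); rewrite -?E1 -?E2.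
Qed.


Lemma related_twist g c x y : related g (Rop c *m g) (Lop (oconj c) *m g) ->
  g *m omul x y = omul (omul (g *m x) c) (omul (oconj c) (g *m y)).
Proof. by move=> R; rewrite (related_mul R) -!mulmxA Rop_mul Lop_mul. Qed.

(** For an automorphism g the relation says xy = (xc)(c^-1 y), which puts c in the
    nucleus. *)
Lemma AutO_scalar_twist g c : g \in unitmx ->
  related g (Rop c *m g) (Lop (oconj c) *m g) ->
  AutO g -> onorm c = 1 -> Rop c *m g = Lop (oconj c) *m g.
Proof.
move=> ug R [_ ga] nc.
have tw x y : omul x y = omul (omul x c) (omul (oconj c) y).
  have := related_twist (invmx g *m x) (invmx g *m y) R.
  by rewrite ga !(mulKVmx ug).
have [s cE] : exists s : F, c = s *: oone F.
  apply: right_nucleus_scalar => x y.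
  rewrite [omul x y]tw isotope.
  rewrite omul_rconj nc scale1r; reflexivity.
apply: operatorP => z; rewrite -!mulmxA !opE cE oconjZ.
by rewrite omulZl omulZr (_ : oconj _ = oone F) ?omul1l ?omul1r //; oct_ring.
Qed.

(** If h has the triple (h, h1, h2) and g = h^-1 k the triple (g, g1, g2), then
    f(h) = f(k) says exactly that g1 = g2 or g1 = -g2. Evaluated with g1 = R_c g and
    g2 = L_{conj c} g this makes c central, hence a scalar of square 1, and the
    relation for g becomes multiplicativity. *)
Lemma fmap_eq h k : SO7 h -> SO7 k ->
  fmap rho h = fmap rho k <-> AutO (invmx h *m k).
Proof.
move=> sh sk; have [h1 [h2 Rh]] := SO7_related F2 Hrho sh.
have uh := SO8_unit sh.1.
have sg := SO7M (SO7V sh) sk; set g := invmx h *m k in sg *.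
have ug := SO8_unit sg.1.
have [c nc Rg] := SO7_twist sg.
have kE : k = h *m g by rewrite mulKVmx.
clearbody g.
have Rk := relatedM Hrho Rh Rg; rewrite -kE in Rk.
have uh1 := SO8_unit (related_SO8l Rh); have uh2 := SO8_unit (related_SO8r Rh).
have ug2 := SO8_unit (related_SO8r Rg).
set g1 := Rop c *m g in Rg Rk *; set g2 := Lop _ *m g in Rg Rk ug2 *.
have fkE : fmap rho k = pclass (K *m (h1 *m (g1 *m invmx g2) *m invmx h2) *m K).
  by rewrite (fmap_related Rk) invmxM // !mulmxA.
have fhE := fmap_related Rh.
split=> [E|Ag]; last first.
  by rewrite fkE fhE /g1 (AutO_scalar_twist ug Rg Ag nc) -/g2 mulmxV // mulmx1.
have {E fkE fhE} : g1 = g2 \/ g1 = - g2.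
  have cancel A B : K *m (h1 *m A *m invmx h2) *m K = K *m (h1 *m B *m invmx h2) *m K -> A = B.
    have kk C : K *m (K *m C *m K) *m K = C.
      by rewrite !mulmxA kappaK mul1mx -mulmxA kappaK mulmx1.
    move=> /(congr1 (fun C => K *m C *m K)); rewrite !kk.
    move=> /(congr1 (fun C => invmx h1 *m C *m h2)).
    by rewrite !mulmxA !mulVmx // !mul1mx !mulmxKV.
  move: E; rewrite fkE fhE -[in X in X = _](mulmx1 h1) => /pclass_eq[/cancel E|].
    by left; rewrite -[LHS](mulmxKV ug2) -E mul1mx.
  have -> : - (K *m (h1 *m (g1 *m invmx g2) *m invmx h2) *m K) =
      K *m (h1 *m (- (g1 *m invmx g2)) *m invmx h2) *m K.
    by rewrite !(mulmxN, mulNmx).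
  move=> /cancel E.
  by right; rewrite -[LHS](mulmxKV ug2) -[_ *m invmx _]opprK -E mulNmx mul1mx.
move=> E12.
have [t cE] : exists t : F, c = t *: oone F.
  apply: commute_all_scalar => z.
  have [s E] : exists s, forall z, omul z c = s *: omul (oconj c) z.
    have ext (s : F) : g1 = s *: g2 -> forall z, omul z c = s *: omul (oconj c) z.
      move=> E y.
      have : g1 *m (invmx g *m y) = (s *: g2) *m (invmx g *m y) by rewrite E.
      by rewrite -scalemxAl /g1 /g2 -!mulmxA !(mulKVmx ug) !opE.
    by case: E12 => E; [exists 1|exists (-1)]; apply: ext; rewrite E ?scale1r ?scaleN1r.
  by rewrite E -omulZl -[oconj c]omul1r -E omul1l.
split; [exact: ug | move=> x y].
rewrite (related_twist x y Rg) cE oconjZ.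
rewrite omulZr !omulZl omulZr scalerA (_ : oconj _ = oone F); last by oct_ring.
rewrite omul1l omul1r -[RHS]scale1r; congr (_ *: _).
by rewrite -[RHS]nc cE onormZ onorm1; ring.
Qed.
End Parametrization.

(** * Cosets of the automorphism group *)

Section Cosets.
Variable F : fieldType.
Implicit Types (h k g : operator F).

Lemma AutO1 : AutO (1%:M : operator F).
Proof. by split=> [|x y]; [exact: unitmx1 | rewrite !mul1mx]. Qed.

Lemma AutOM g k : AutO g -> AutO k -> AutO (g *m k).
Proof.
move=> [ug Eg] [uk Ek]; split=> [|x y]; first by rewrite unitmx_mul ug.
by rewrite -!mulmxA Ek Eg.
Qed.

Lemma AutOV g : AutO g -> AutO (invmx g).
Proof.
move=> [ug Eg]; split=> [|x y]; first by rewrite unitmx_inv.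
by rewrite -[omul x y in LHS]/(omul x y) -{1}[x](mulKVmx ug) -{1}[y](mulKVmx ug) -Eg mulKmx.
Qed.

Lemma lcoset_AutO h k : h \in unitmx ->
  lcoset h (@AutO F) = lcoset k (@AutO F) <-> AutO (invmx h *m k).
Proof.
move=> uh; split=> [E|Ag].
  have : lcoset k (@AutO F) k by exists 1%:M; [exact: AutO1 | rewrite mulmx1].
  by rewrite -E => -[g Ag <-]; rewrite mulKmx.
apply/seteqP; split=> _ [g Ag' <-].
  exists (invmx (invmx h *m k) *m g); first by apply: AutOM => //; exact: AutOV.
  by rewrite mulmxA -{1}[k](mulKVmx uh) mulmxK //; case: Ag.
by exists (invmx h *m k *m g); [exact: AutOM | rewrite !mulmxA mulmxV // mul1mx].
Qed.
End Cosets.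

Section Sections.
Variable F : closedFieldType.
Hypothesis F2 : 2%:R != 0 :> F.
Variable rho : set (operator F) -> set (operator F).
Hypothesis Hrho : is_triality rho.
Implicit Types (a b c d x y z : octonion F) (A B h k g : operator F).

Local Notation K := (kappa F).
Local Notation related := (related rho).

Lemma fmap_lcoset h k : SO7 h -> SO7 k ->
  fmap rho h = fmap rho k <-> lcoset h (@AutO F) = lcoset k (@AutO F).
Proof.
move=> sh sk; rewrite (fmap_eq F2 Hrho sh sk); split=> /lcoset_AutO; apply.
  exact: SO8_unit sh.1.
exact: SO8_unit sh.1.
Qed.

(** * Elements of SO(7) with a prescribed image *)
Lemma oform_one_mul a c : oform (omul a c) (oone F) = oform c (oconj a).
Proof. oct_coord a; oct_coord c; oct_ring. Qed.

Lemma imaginary_mul a c : imaginary a -> oform a c = 0 -> imaginary (omul a c).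
Proof. by move=> a0 ac; rewrite /imaginary oform_one_mul oconj_imaginary // oformNr oformC ac oppr0. Qed.

Lemma imaginary_square a : imaginary a -> omul a a = - onorm a *: oone F.
Proof.
move=> a0; rewrite scaleNr -omul_conjl (oconj_imaginary a0) omulNl opprK omul1r.
reflexivity.
Qed.

(** For imaginary a orthogonal to c, also b = ac is imaginary, and the composite of the
    reflections in a and b is B_a B_b divided by n(a) n(b). Its triple has
    h1 = L_a L_b up to scale, so h1(1) is proportional to ab = -n(a) c. *)
Definition lift_twist a c :=
  (onorm a * onorm (omul a c))^-1 *: (bimul a *m bimul (omul a c)).

Lemma bimulZ (s : F) a : bimul (s *: a) = s ^+ 2 *: bimul a.
Proof.
apply: operatorP => z; rewrite -scalemxAl !bimulE omulZr !omulZl scalerA.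
by rewrite expr2.
Qed.

Lemma bimul_pair a b : imaginary_unit a -> imaginary_unit b ->
  SO7 (bimul a *m bimul b) /\ fmap rho (bimul a *m bimul b) = Pbar (omul a b).
Proof.
move=> [a0 na] [b0 nb].
have R := relatedM Hrho (related_bimul F2 Hrho na) (related_bimul F2 Hrho nb).
have e : bimul a *m bimul b *m oone F = oone F.
  rewrite -mulmxA !bimulE omul1r (imaginary_square b0) omulZr omul1r omulZl.
  by rewrite (imaginary_square a0) scalerA na nb mulrNN mul1r scale1r.
split; first by split=> //; exact: related_SO8 R.
by rewrite (fmap_Pbar F2 R e) -mulmxA !Lop_mul omul1r.
Qed.

Lemma Pop_mul c z : onorm c = 1 -> Pop c *m z = omul (oconj c) (omul z (oconj c)).
Proof. by move=> nc; rewrite Pop_sandwich // -mulmxA Rop_mul Lop_mul. Qed.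

Lemma PbarN c : onorm c = 1 -> Pbar (- c) = Pbar c.
Proof.
move=> nc; apply: (congr1 (@pclass F)); apply: operatorP => z.
rewrite (Pop_mul z nc) (Pop_mul z (etrans (onormN c) nc)).
have -> : oconj (- c) = - oconj c by rewrite -!scaleN1r oconjZ.
by rewrite omulNl !omulNr opprK.
Qed.

Lemma lift_twistP a c : imaginary a -> oform a c = 0 -> onorm a != 0 -> onorm c = 1 ->
  SO7 (lift_twist a c) /\ fmap rho (lift_twist a c) = Pbar c.
Proof.
move=> a0 ac na nc; have [s s0 ns] := normalize na.
have ia : imaginary_unit (s *: a) by split=> //; rewrite /imaginary oformZl a0 mulr0.
have b0 := imaginary_mul a0 ac.
have ib : imaginary_unit (s *: omul a c).
  split; first by rewrite /imaginary oformZl b0 mulr0.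
  by move: ns; rewrite !onormZ onormM nc mulr1.
have [S E] := bimul_pair ia ib.
have LE : lift_twist a c = bimul (s *: a) *m bimul (s *: omul a c).
  rewrite !bimulZ -scalemxAl -scalemxAr scalerA /lift_twist; congr (_ *: _).
  move: ns; rewrite onormM nc mulr1 onormZ => ns.
  have -> : s ^+ 2 = (onorm a)^-1 by apply: (mulIf na); rewrite ns mulVf.
  by rewrite invfM.
rewrite LE E omulZl omulZr left_alternative (imaginary_square a0) omulZl omul1l.
split; first exact: S.
rewrite !scalerA mulrN -expr2 scaleNr.
by move: ns; rewrite onormZ => ->; rewrite scale1r (PbarN nc).
Qed.

(** Homogeneity of degree zero: the construction depends only on the lines through a
    and c, hence in particular not on the sign of c. *)
Lemma lift_twistZ (s t : F) a c : s != 0 -> t != 0 ->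
  lift_twist (s *: a) (t *: c) = lift_twist a c.
Proof.
move=> s0 t0; rewrite /lift_twist omulZl omulZr !bimulZ !onormZ.
rewrite -scalemxAl -!scalemxAr !scalerA; congr (_ *: _).
have [->|na] := eqVneq (onorm a) 0; first by rewrite !(mulr0, mul0r, invr0).
have [->|nb] := eqVneq (onorm (omul a c)) 0; first by rewrite !(mulr0, mul0r, invr0).
by field; rewrite s0 t0 na nb.
Qed.

Lemma exists_imaginary_normal c : exists a, [/\ imaginary a, oform a c = 0 & onorm a != 0].
Proof.
have [r [r0 [r1 [r2 [r3 [r4 [r5 [r6 ->]]]]]]]] := octP c.
suff [x [y [x1 [y1 [x2 [y2 [t [E N]]]]]]]] : exists x y x1 y1 x2 y2 t : F,
    t * (r6 - r) = x * r3 + y * r0 + (x1 * r4 + y1 * r1) + (x2 * r5 + y2 * r2) /\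
    t ^+ 2 + (x * y + x1 * y1 + x2 * y2) != 0.
  exists (oct t x x1 x2 y y1 y2 (- t)); rewrite /imaginary !octE; split.
  - by ring.
  - transitivity (t * (r6 - r) - (x * r3 + y * r0 + (x1 * r4 + y1 * r1) + (x2 * r5 + y2 * r2))).
      by ring.
    by rewrite E subrr.
  - move: N; rewrite -oppr_eq0; congr (_ != 0); ring.
(* With t = 1 a single coordinate x (or y) can be used to restore orthogonality
   without changing the norm; if c has no component along the first pair of
   coordinates, that hyperbolic plane itself contains a suitable a. *)
have [r3_0|r3_n0] := eqVneq r3 0; last first.
  exists ((r6 - r) / r3), 0, 0, 0, 0, 0, 1; rewrite !(mul0r, mulr0, addr0, expr1n) mul1r divfK //.
  by split=> //; exact: oner_neq0.
have [r0_0|r0_n0] := eqVneq r0 0; last first.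
  exists 0, ((r6 - r) / r0), 0, 0, 0, 0, 1; rewrite !(mul0r, mulr0, addr0, add0r, expr1n) mul1r divfK //.
  by split=> //; exact: oner_neq0.
exists 1, 1, 0, 0, 0, 0, 0; rewrite r3_0 r0_0 !(mul0r, mulr0, addr0, add0r, expr0n) mulr1.
by split=> //; exact: oner_neq0.
Qed.

Lemma fmap_surjective c : onorm c = 1 -> exists2 h, SO7 h & fmap rho h = Pbar c.
Proof.
move=> nc; have [a [a0 ac na]] := exists_imaginary_normal c.
by have [S E] := lift_twistP a0 ac na nc; exists (lift_twist a c).
Qed.

(** * A polynomial formula for f *)
(** This is h L_{h^-1 x} h^-1, written with the adjugate so as to be polynomial in h.
    It equals R_c^-1 L_x R_c by the isotope identity. *)
Definition conj_Lop h x := h *m Lop (\adj h *m x) *m \adj h.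

Definition unit_u i : octonion F := zorn 0 (delta_mx i 0) 0 0.
Definition unit_v i : octonion F := zorn 0 0 (delta_mx i 0) 0.

(** For M = [Lop] the product of the three left multiplications by u_1, u_2, u_3 is a
    matrix unit at the corner (alpha, beta), and the v_i give minus the transposed one. *)
Definition corner (M : octonion F -> operator F) (e : 'I_3 -> octonion F) :=
  M (e 0) *m M (e 1) *m M (e 2%:R).

(** The left multiplications generate all operators; this word in them produces the
    operator z |-> t(z) 1 from which P_c can be read off after conjugation by R_c. *)
Definition trace_word (M : octonion F -> operator F) :=
  let X := corner M unit_u in let Y := corner M unit_v in
  X - Y - X *m Y - Y *m X.

Lemma unit_u_oct : (unit_u 0 = oct 0 1 0 0 0 0 0 0) * (unit_u 1 = oct 0 0 1 0 0 0 0 0) *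
  (unit_u 2%:R = oct 0 0 0 1 0 0 0 0).
Proof. by rewrite /unit_u /oct; do 2?split; congr zorn; rewrite [LHS]col3P !mxE. Qed.
Lemma unit_v_oct : (unit_v 0 = oct 0 0 0 0 1 0 0 0) * (unit_v 1 = oct 0 0 0 0 0 1 0 0) *
  (unit_v 2%:R = oct 0 0 0 0 0 0 1 0).
Proof. by rewrite /unit_v /oct; do 2?split; congr zorn; rewrite [LHS]col3P !mxE. Qed.

Lemma corner_u r0 r1 r2 r3 r4 r5 r6 r7 :
  corner (@Lop F) unit_u *m oct r0 r1 r2 r3 r4 r5 r6 r7 = oct r7 0 0 0 0 0 0 0.
Proof. by rewrite /corner !unit_u_oct -!mulmxA !Lop_mul; oct_ring. Qed.
Lemma corner_v r0 r1 r2 r3 r4 r5 r6 r7 :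
  corner (@Lop F) unit_v *m oct r0 r1 r2 r3 r4 r5 r6 r7 = oct 0 0 0 0 0 0 0 (- r0).
Proof. by rewrite /corner !unit_v_oct -!mulmxA !Lop_mul; oct_ring. Qed.

Lemma trace_word_Lop z : trace_word (@Lop F) *m z = oform z (oone F) *: oone F.
Proof.
rewrite /trace_word.
move: (corner _ unit_u) corner_u (corner _ unit_v) corner_v => U uE V vE.
rewrite !mulmxBl -!mulmxA; oct_coord z; rewrite !(uE, vE); oct_ring.
Qed.

Lemma trace_word_conj (M : octonion F -> operator F) A B : A *m B = 1%:M ->
  (forall x, M x = B *m Lop x *m A) -> trace_word M = B *m trace_word (@Lop F) *m A.
Proof.
move=> AB ME.
have conjM X Y : (B *m X *m A) *m (B *m Y *m A) = B *m (X *m Y) *m A.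
  by rewrite !mulmxA -(mulmxA _ A B) AB mulmx1.
have cE e : corner M e = B *m corner (@Lop F) e *m A by rewrite /corner !ME !conjM.
rewrite /trace_word (cE unit_u) (cE unit_v).
move: (corner _ unit_u) (corner _ unit_v) => U V.
by rewrite !conjM !(mulmxBr, mulmxBl).
Qed.

(** Conjugating z |-> t(z) 1 by R_c gives z |-> q(z, conj c) conj c, quadratic in c and
    so blind to its sign. By [sandwich_conj], subtracting z and composing with [kappa]
    turns this into P_c. *)
Definition theta h : operator F := (trace_word (conj_Lop h) - 1%:M) *m K.

Lemma invmx_SO8 h : SO8 h -> invmx h = \adj h.
Proof. by move=> sh; rewrite /invmx (SO8_unit sh) sh.1 invr1 scale1r. Qed.

Lemma conj_Lop_twist h c x : onorm c = 1 -> SO7 h ->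
  related h (Rop c *m h) (Lop (oconj c) *m h) ->
  conj_Lop h x = Rop (oconj c) *m Lop x *m Rop c.
Proof.
move=> nc sh R; rewrite /conj_Lop -(invmx_SO8 sh.1); have uh := SO8_unit sh.1.
apply: operatorP => z; rewrite -!mulmxA Lop_mul (related_twist _ _ R).
by rewrite !(mulKVmx uh) isotope !(Lop_mul, Rop_mul).
Qed.

Lemma oform_mul_one z c : oform (omul z c) (oone F) = oform z (oconj c).
Proof. oct_coord z; oct_coord c; oct_ring. Qed.

(** Although c is determined by h only up to sign, P_c itself is represented by a
    matrix polynomial in h. *)
Lemma theta_Pbar h : SO7 h -> SO8 (theta h) /\ fmap rho h = pclass (theta h).
Proof.
move=> sh; have [c nc R] := SO7_twist F2 Hrho sh.
have nc' : onorm (oconj c) = 1 by rewrite onorm_conj.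
have -> : theta h = Pop c.
  have RR : Rop c *m Rop (oconj c) = 1%:M by have := Rop_conj nc'; rewrite oconjK.
  rewrite /theta (trace_word_conj RR (fun x => conj_Lop_twist x nc sh R)).
  apply: operatorP => z; rewrite (Pop_mul z nc) -flexible -!mulmxA mulmxBl mul1mx kappa_mul.
  rewrite -!mulmxA !Rop_mul trace_word_Lop omulZl omul1l.
  by rewrite -[z in RHS]oconjK sandwich_conj nc' scale1r oform_mul_one.
split; last by rewrite (fmap_Pbar F2 R sh.2) -mulmxA sh.2 Rop_mul omul1l.
rewrite (Pop_sandwich nc); apply: SO8M; first exact: SO8_Lop.
exact: SO8_Rop.
Qed.

End Sections.

(** * Local sections of f *)

Section LocalSection.
Variable F : closedFieldType.
Hypothesis F2 : 2%:R != 0 :> F.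
Variable rho : set (operator F) -> set (operator F).
Hypothesis Hrho : is_triality rho.
Implicit Types (a b c d x y z v w : octonion F) (A B h k g : operator F).

Local Notation K := (kappa F).
Local Notation related := (related rho).

Definition e_alpha : octonion F := zorn 1 0 0 0.
Definition e_beta : octonion F := zorn 0 0 0 1.

(** If A = P_c or -P_c and w = conj c, the first column of A is, up to sign,
    alpha(w) w - e_beta: a multiple of w except in the last coordinate, which is corrected with
    the entries of a second column. Being quadratic in A the result ignores the
    sign. *)
Definition recover A : octonion F :=
  let x := A *m e_alpha in let y := A *m unit_u F 0 in
  zalpha y *: x + (zalpha x * zbeta y - zalpha y * zbeta x) *: e_beta.

Lemma zalphaN x : zalpha (- x) = - zalpha x.
Proof. by rewrite -scaleN1r [x]zornP zornZ !zalphaE mulN1r. Qed.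
Lemma zbetaN x : zbeta (- x) = - zbeta x.
Proof. by rewrite -scaleN1r [x]zornP zornZ !zbetaE mulN1r. Qed.

Lemma recoverN A : recover (- A) = recover A.
Proof.
rewrite /recover !mulNmx !zalphaN !zbetaN.
rewrite scaleNr scalerN opprK; congr (_ + _ *: _); ring.
Qed.

Lemma e_alpha_oct : e_alpha = oct 1 0 0 0 0 0 0 0.
Proof. by rewrite /e_alpha /oct; congr zorn; rewrite [LHS]col3P !mxE. Qed.
Lemma e_beta_oct : e_beta = oct 0 0 0 0 0 0 0 1.
Proof. by rewrite /e_beta /oct; congr zorn; rewrite [LHS]col3P !mxE. Qed.
Lemma zalpha_oct r0 r1 r2 r3 r4 r5 r6 r7 : zalpha (oct r0 r1 r2 r3 r4 r5 r6 r7 : octonion F) = r0.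
Proof. exact: zalphaE. Qed.
Lemma zbeta_oct r0 r1 r2 r3 r4 r5 r6 r7 : zbeta (oct r0 r1 r2 r3 r4 r5 r6 r7 : octonion F) = r7.
Proof. exact: zbetaE. Qed.
Lemma zv0_oct r0 r1 r2 r3 r4 r5 r6 r7 : zv (oct r0 r1 r2 r3 r4 r5 r6 r7 : octonion F) 0 0 = r4.
Proof. by rewrite /oct zvE !mxE. Qed.

Lemma recover_Pop c : onorm c = 1 ->
  recover (Pop c) = (zalpha (oconj c) ^+ 2 * zv (oconj c) 0 0) *: oconj c.
Proof.
move=> nc; rewrite /recover (Pop_mul e_alpha nc) (Pop_mul (unit_u F 0) nc).
rewrite e_alpha_oct e_beta_oct unit_u_oct.
oct_coord c; rewrite !(octE, zalpha_oct, zbeta_oct, zv0_oct); congr oct; ring.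
Qed.

(** Chosen to depend linearly on v = (alpha, u; w, beta), to be imaginary and orthogonal
    to v and conj v, and to have norm -w_1^2, so that it serves wherever w_1 is not 0. *)
Definition normal_witness v : octonion F :=
  zorn (zv v 0 0) ((zbeta v - zalpha v) *: delta_mx 0 0) 0 (- zv v 0 0).

Lemma normal_witness_oct r0 r1 r2 r3 r4 r5 r6 r7 :
  normal_witness (oct r0 r1 r2 r3 r4 r5 r6 r7) = oct r4 (r7 - r0) 0 0 0 0 0 (- r4).
Proof.
rewrite /normal_witness zalpha_oct zbeta_oct zv0_oct /oct.
by congr zorn; rewrite [LHS]col3P !mxE ?mulr0 ?mulr1.
Qed.

Lemma normal_witnessZ (s : F) v : normal_witness (s *: v) = s *: normal_witness v.
Proof. by oct_coord v; rewrite !(octE, normal_witness_oct); congr oct; ring. Qed.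

Lemma imaginary_witness v : imaginary (normal_witness v).
Proof. by rewrite /imaginary; oct_coord v; rewrite normal_witness_oct !octE; ring. Qed.

Lemma oform_witness v : oform (normal_witness v) (oconj v) = 0.
Proof. by oct_coord v; rewrite normal_witness_oct !octE; ring. Qed.

Definition twist_section v := lift_twist (normal_witness v) (oconj v).
Definition section_denom v := onorm (normal_witness v) * onorm (omul (normal_witness v) (oconj v)).

Lemma section_recover A c : onorm c = 1 -> pclass A = Pbar c -> section_denom (recover A) != 0 ->
  SO7 (twist_section (recover A)) /\ fmap rho (twist_section (recover A)) = pclass A.
Proof.
move=> nc EA.
have -> : recover A = recover (Pop c).
  by case/pclass_eq: EA => ->; rewrite ?recoverN.
rewrite (recover_Pop nc); set t := _ * _; set w := oconj c.
rewrite /twist_section /section_denom normal_witnessZ oconjZ /w oconjK => D.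
have t0 : t != 0 by apply: contraNneq D => ->; rewrite scale0r onormZ expr0n !mul0r.
have na : onorm (normal_witness (oconj c)) != 0.
  by apply: contraNneq D => n0; rewrite onormZ n0 mulr0 mul0r.
have orth : oform (normal_witness (oconj c)) c = 0 by have := oform_witness (oconj c); rewrite oconjK.
by rewrite lift_twistZ // EA; apply: lift_twistP => //; exact: imaginary_witness.
Qed.

(** A norm-one octonion whose conjugate has nonzero coordinates alpha and v_1, so that
    the section is defined near its image in V. *)
Definition base_twist : octonion F := oct 1 0 0 0 (-1) 0 0 1.

Lemma onorm_base_twist : onorm base_twist = 1.
Proof. by rewrite /base_twist !octE; ring. Qed.

Lemma section_denom_base : section_denom (recover (Pop base_twist)) != 0.
Proof.
rewrite (recover_Pop onorm_base_twist) /base_twist.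
rewrite (_ : _ *: _ = oct 1 0 0 0 1 0 0 1); last first.
  by rewrite !(octE, zalpha_oct, zv0_oct); congr oct; ring.
rewrite /section_denom normal_witness_oct !octE (_ : _ * _ = 1) ?oner_neq0 //; ring.
Qed.

(** SO(7) acts on V by X |-> rho^2(k) X rho(k)^-1, and f is equivariant. *)
Lemma fmap_mul k k1 k2 h B : related k k1 k2 -> SO7 h -> fmap rho h = pclass B ->
  fmap rho (k *m h) = pclass ((K *m k1 *m K) *m B *m invmx (K *m k2 *m K)).
Proof.
move=> Rk sh; have [h1 [h2 Rh]] := SO7_related F2 Hrho sh.
have uk2 := SO8_unit (related_SO8r Rk); have uh2 := SO8_unit (related_SO8r Rh).
rewrite (fmap_related Rh) (fmap_related (relatedM Hrho Rk Rh)) => EB.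
have split3 (X Y Z : operator F) :
    pclass (X *m Y *m Z) = coset_mul (coset_mul (pclass X) (pclass Y)) (pclass Z).
  by rewrite !pclassM.
rewrite [RHS]split3 -EB -split3; apply: (congr1 (@pclass F)).
by rewrite (invmx_kappa uk2) (invmxM uk2 uh2) -!kappa_conjM !mulmxA.
Qed.

(** A translate of the section: [tr_left] and [tr_right] carry a point of PSO(8) back to
    the neighbourhood where [recover] works, [tr_lift] moves the lifted element
    forward. *)
Record transport := Transport { tr_left : operator F; tr_right : operator F; tr_lift : operator F }.
Definition transported t A := recover (tr_left t *m A *m tr_right t).
Definition local_lift t A := tr_lift t *m twist_section (transported t A).
Definition local_denom t A := section_denom (transported t A).

(** By equivariance one section near a single point of V provides one near every
    point; k = h0 hs^-1 moves the base point to f(h0). *)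
Lemma local_section h0 : SO7 h0 -> exists t,
  (forall A, pclass A = fmap rho h0 -> local_denom t A != 0) /\
  (forall A h, SO7 h -> pclass A = fmap rho h -> local_denom t A != 0 ->
     SO7 (local_lift t A) /\ fmap rho (local_lift t A) = pclass A).
Proof.
move=> s0; have [hs ss Es] := fmap_surjective F2 Hrho onorm_base_twist.
have sk := SO7M s0 (SO7V ss); set k := h0 *m invmx hs in sk.
have h0E : h0 = k *m hs by rewrite mulmxKV //; exact: SO8_unit ss.1.
clearbody k.
have [k1 [k2 Rk]] := SO7_related F2 Hrho sk.
have uk := SO8_unit sk.1.
set K2 := K *m k1 *m K; set K1 := K *m k2 *m K.
have uK2 : K2 \in unitmx by apply/SO8_unit/SO8_kappa => //; exact: related_SO8l Rk.
have uK1 : K1 \in unitmx by apply/SO8_unit/SO8_kappa => //; exact: related_SO8r Rk.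
have mulE h B : SO7 h -> fmap rho h = pclass B -> fmap rho (k *m h) = pclass (K2 *m B *m invmx K1).
  exact: fmap_mul Rk.
clearbody K2 K1.
exists (Transport (invmx K2) K1 k).
have back A B : pclass A = pclass (K2 *m B *m invmx K1) ->
    pclass (invmx K2 *m A *m K1) = pclass B.
  have cancel : invmx K2 *m (K2 *m B *m invmx K1) *m K1 = B.
    by rewrite -mulmxA mulmxKV // mulKmx.
  case/pclass_eq => ->; first by rewrite cancel.
  by rewrite mulmxN mulNmx cancel pclassN.
have forth A : pclass A = pclass (K2 *m (invmx K2 *m A *m K1) *m invmx K1).
  by rewrite !mulmxA mulmxV // mul1mx mulmxK.
split=> [A|A h sh] EA.
  move: EA; rewrite h0E (mulE _ _ ss Es) => /back/pclass_eq EA.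
  rewrite /local_denom /transported /=.
  have -> : recover (invmx K2 *m A *m K1) = recover (Pop base_twist).
    by case: EA => ->; rewrite ?recoverN.
  exact: section_denom_base.
have sg := SO7M (SO7V sk) sh.
have [c nc Rc] := SO7_twist F2 Hrho sg.
have Ec : fmap rho (invmx k *m h) = Pbar c.
  by rewrite (fmap_Pbar F2 Rc sg.2) -mulmxA sg.2 Rop_mul omul1l.
have EA' : pclass (invmx K2 *m A *m K1) = Pbar c.
  by apply: back; rewrite EA -(mulE _ _ sg Ec) mulKVmx.
move=> D; have [sl El] := section_recover nc EA' D.
by split; [exact: SO7M | rewrite (mulE _ _ sl El) -forth].
Qed.

Lemma local_liftN t A : local_lift t (- A) = local_lift t A.
Proof. by rewrite /local_lift /transported mulmxN mulNmx recoverN. Qed.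
Lemma local_denomN t A : local_denom t (- A) = local_denom t A.
Proof. by rewrite /local_denom /transported mulmxN mulNmx recoverN. Qed.

End LocalSection.

(** * Germs of regular functions *)

Section Germs.
Local Open Scope classical_set_scope.
Variables (F : fieldType) (m n : nat).
Implicit Types (S : set 'M[F]_(m, n)) (x y : 'M[F]_(m, n)) (f g : 'M[F]_(m, n) -> F).
Implicit Types (p q a b : {mpoly F[m * n]}).

(** The germ at x of a function on S is a quotient of polynomials. Every regularity
    question below is asked at a point, where these germs form a ring in which
    functions not vanishing at x are invertible. *)
Definition regular_at S x f := exists a b, mxeval b x != 0 /\
  forall y, S y -> mxeval b y != 0 -> f y = mxeval a y / mxeval b y.

(** P holds on a Zariski neighbourhood of x in S. *)
Definition near_in S x (P : set 'M[F]_(m, n)) :=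
  exists p, mxeval p x != 0 /\ forall y, S y -> mxeval p y != 0 -> P y.

Lemma mxevalM p q x : mxeval (p * q) x = mxeval p x * mxeval q x.
Proof. exact: mevalM. Qed.
Lemma mxevalD p q x : mxeval (p + q) x = mxeval p x + mxeval q x.
Proof. exact: mevalD. Qed.
Lemma mxeval1 x : mxeval 1 x = 1.
Proof. exact: meval1. Qed.

Lemma mxevalM_neq0 p q x : (mxeval (p * q) x != 0) = (mxeval p x != 0) && (mxeval q x != 0).
Proof. by rewrite mxevalM mulf_eq0 negb_or. Qed.

Lemma near_inT S x (P : set 'M[F]_(m, n)) : (forall y, S y -> P y) -> near_in S x P.
Proof. by move=> SP; exists 1; split=> [|y /SP//]; rewrite mxeval1 oner_neq0. Qed.

Lemma near_inI S x (P Q R : set 'M[F]_(m, n)) :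
  (forall y, S y -> P y -> Q y -> R y) ->
  near_in S x P -> near_in S x Q -> near_in S x R.
Proof.
move=> PQR [p [px pP]] [q [qx qQ]]; exists (p * q); rewrite mxevalM_neq0 px qx.
by split=> // y Sy; rewrite mxevalM_neq0 => /andP[py qy]; apply: PQR => //; [exact: pP | exact: qQ].
Qed.

Lemma regular_at_near S S' x f g :
  near_in S x [set y | S' y /\ f y = g y] -> regular_at S' x g -> regular_at S x f.
Proof.
move=> [p [px pP]] [a [b [bx bg]]]; exists (a * p), (b * p).
rewrite mxevalM_neq0 px bx; split=> // y Sy; rewrite mxevalM_neq0 => /andP[by0 py].
have [S'y ->] := pP y Sy py.
by rewrite bg // !mxevalM -mulf_div divff // mulr1.
Qed.

Lemma regular_at_eq S x f g : (forall y, S y -> f y = g y) -> regular_at S x g -> regular_at S x f.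
Proof. by move=> fg; apply: regular_at_near; apply: near_inT => y Sy; split=> //; exact: fg. Qed.

Lemma regular_at_poly S x p : regular_at S x (mxeval p).
Proof. by exists p, 1; rewrite mxeval1 oner_neq0; split=> // y _ _; rewrite mxeval1 divr1. Qed.

Lemma regular_at_cst S x (c : F) : regular_at S x (fun=> c).
Proof. by apply: (regular_at_eq _ (regular_at_poly S x c%:MP)) => y _; rewrite /mxeval mevalC. Qed.

Lemma regular_at_entry S x i j : regular_at S x (fun y => y i j).
Proof.
apply: (regular_at_eq _ (regular_at_poly S x 'X_(mxvec_index i j))) => y _.
by rewrite /mxeval mevalXU mxvecE.
Qed.

Lemma regular_atM S x f g : regular_at S x f -> regular_at S x g -> regular_at S x (fun y => f y * g y).
Proof.
move=> [a [b [bx bf]]] [c [d [dx dg]]]; exists (a * c), (b * d).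
rewrite mxevalM_neq0 bx dx; split=> // y Sy; rewrite mxevalM_neq0 => /andP[by0 dy0].
by rewrite bf // dg // !mxevalM mulf_div.
Qed.

Lemma regular_atD S x f g : regular_at S x f -> regular_at S x g -> regular_at S x (fun y => f y + g y).
Proof.
move=> [a [b [bx bf]]] [c [d [dx dg]]]; exists (a * d + c * b), (b * d).
rewrite mxevalM_neq0 bx dx; split=> // y Sy; rewrite mxevalM_neq0 => /andP[by0 dy0].
by rewrite bf // dg // !(mxevalM, mxevalD) addf_div.
Qed.

Lemma regular_atN S x f : regular_at S x f -> regular_at S x (fun y => - f y).
Proof.
move=> rf; apply: (regular_at_eq _ (regular_atM (regular_at_cst S x (-1)) rf)) => y _.
by rewrite mulN1r.
Qed.

Lemma regular_atV S x f : S x -> f x != 0 -> regular_at S x f -> regular_at S x (fun y => (f y)^-1).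
Proof.
move=> Sx fx [a [b [bx bf]]]; exists (b * b), (a * b).
have ax : mxeval a x != 0.
  by apply: contraNneq fx => ax; rewrite bf // ax mul0r.
rewrite mxevalM_neq0 ax bx; split=> // y Sy; rewrite mxevalM_neq0 => /andP[ay0 by0].
by rewrite bf // !mxevalM invf_div -mulf_div divff // mulr1.
Qed.

Lemma regular_at_sum S x (I : Type) (r : seq I) (f : I -> 'M[F]_(m, n) -> F) :
  (forall i, regular_at S x (f i)) -> regular_at S x (fun y => \sum_(i <- r) f i y).
Proof.
move=> rf; elim: r => [|i r IH].
  by apply: (regular_at_eq _ (regular_at_cst S x 0)) => y _; rewrite big_nil.
by apply: (regular_at_eq _ (regular_atD (rf i) IH)) => y _; rewrite big_cons.
Qed.

Lemma regular_at_prod S x (I : Type) (r : seq I) (f : I -> 'M[F]_(m, n) -> F) :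
  (forall i, regular_at S x (f i)) -> regular_at S x (fun y => \prod_(i <- r) f i y).
Proof.
move=> rf; elim: r => [|i r IH].
  by apply: (regular_at_eq _ (regular_at_cst S x 1)) => y _; rewrite big_nil.
by apply: (regular_at_eq _ (regular_atM (rf i) IH)) => y _; rewrite big_cons.
Qed.

Lemma regular_at_exp S x f k : regular_at S x f -> regular_at S x (fun y => f y ^+ k).
Proof.
move=> rf; elim: k => [|k IH].
  by apply: (regular_at_eq _ (regular_at_cst S x 1)) => y _; rewrite expr0.
by apply: (regular_at_eq _ (regular_atM rf IH)) => y _; rewrite exprS.
Qed.

Lemma regular_at_neq0 S x f : S x -> f x != 0 -> regular_at S x f ->
  near_in S x [set y | f y != 0].
Proof.
move=> Sx fx [a [b [bx bf]]]; exists (a * b).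
have ax : mxeval a x != 0.
  by apply: contraNneq fx => ax; rewrite bf // ax mul0r.
rewrite mxevalM_neq0 ax bx; split=> // y Sy; rewrite mxevalM_neq0 => /andP[ay0 by0] /=.
by rewrite bf // mulf_neq0 ?invr_eq0.
Qed.

Definition regular_mx_at S x k l (Phi : 'M[F]_(m, n) -> 'M[F]_(k, l)) :=
  forall i j, regular_at S x (fun y => Phi y i j).

Lemma regular_mx_id S x : regular_mx_at S x id.
Proof. by move=> i j; exact: regular_at_entry. Qed.

Lemma regular_mx_cst S x k l (A : 'M[F]_(k, l)) : regular_mx_at S x (fun=> A).
Proof. by move=> i j; exact: regular_at_cst. Qed.

Lemma regular_mxM S x k l r (Phi : 'M[F]_(m, n) -> 'M[F]_(k, l))
    (Psi : 'M[F]_(m, n) -> 'M[F]_(l, r)) :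
  regular_mx_at S x Phi -> regular_mx_at S x Psi -> regular_mx_at S x (fun y => Phi y *m Psi y).
Proof.
move=> rP rQ i j; apply: (@regular_at_eq _ _ _ (fun y => \sum_h Phi y i h * Psi y h j)).
  by move=> y _; rewrite mxE.
by apply: regular_at_sum => h; exact: regular_atM.
Qed.

Lemma regular_mxD S x k l (Phi Psi : 'M[F]_(m, n) -> 'M[F]_(k, l)) :
  regular_mx_at S x Phi -> regular_mx_at S x Psi -> regular_mx_at S x (fun y => Phi y + Psi y).
Proof.
move=> rP rQ i j; apply: (regular_at_eq _ (regular_atD (rP i j) (rQ i j))).
by move=> y _; rewrite mxE.
Qed.

Lemma regular_mxN S x k l (Phi : 'M[F]_(m, n) -> 'M[F]_(k, l)) :
  regular_mx_at S x Phi -> regular_mx_at S x (fun y => - Phi y).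
Proof. by move=> rP i j; apply: (regular_at_eq _ (regular_atN (rP i j))) => y _; rewrite mxE. Qed.

Lemma regular_mxZ S x k l f (Phi : 'M[F]_(m, n) -> 'M[F]_(k, l)) :
  regular_at S x f -> regular_mx_at S x Phi -> regular_mx_at S x (fun y => f y *: Phi y).
Proof. by move=> rf rP i j; apply: (regular_at_eq _ (regular_atM rf (rP i j))) => y _; rewrite mxE. Qed.

Lemma regular_det S x k (Phi : 'M[F]_(m, n) -> 'M[F]_k) :
  regular_mx_at S x Phi -> regular_at S x (fun y => \det (Phi y)).
Proof.
move=> rP; apply: regular_at_sum => s; apply: regular_atM; first exact: regular_at_cst.
by apply: regular_at_prod => i; exact: rP.
Qed.

Lemma regular_adj S x k (Phi : 'M[F]_(m, n) -> 'M[F]_k) :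
  regular_mx_at S x Phi -> regular_mx_at S x (fun y => \adj (Phi y)).
Proof.
move=> rP i j; apply: (@regular_at_eq _ _ _ (fun y => cofactor (Phi y) j i)).
  by move=> y _; rewrite mxE.
apply: regular_atM; first exact: regular_at_cst.
apply: regular_det => k1 k2; apply: (@regular_at_eq _ _ _ (fun y => Phi y (lift j k1) (lift i k2))).
  by move=> y _; rewrite !mxE.
exact: rP.
Qed.

Lemma regular_col_mx S x k1 k2 l (Phi : 'M[F]_(m, n) -> 'M[F]_(k1, l))
    (Psi : 'M[F]_(m, n) -> 'M[F]_(k2, l)) :
  regular_mx_at S x Phi -> regular_mx_at S x Psi -> regular_mx_at S x (fun y => col_mx (Phi y) (Psi y)).
Proof.
move=> rP rQ i j; rewrite -[i]splitK; case: (fintype.split i) => h /=.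
  by apply: (regular_at_eq _ (rP h j)) => y _; rewrite col_mxEu.
by apply: (regular_at_eq _ (rQ h j)) => y _; rewrite col_mxEd.
Qed.

Lemma regular_usubmx S x k1 k2 l (Phi : 'M[F]_(m, n) -> 'M[F]_(k1 + k2, l)) :
  regular_mx_at S x Phi -> regular_mx_at S x (fun y => usubmx (Phi y)).
Proof. by move=> rP i j; apply: (regular_at_eq _ (rP (lshift k2 i) j)) => y _; rewrite mxE. Qed.
Lemma regular_dsubmx S x k1 k2 l (Phi : 'M[F]_(m, n) -> 'M[F]_(k1 + k2, l)) :
  regular_mx_at S x Phi -> regular_mx_at S x (fun y => dsubmx (Phi y)).
Proof. by move=> rP i j; apply: (regular_at_eq _ (rP (rshift k1 i) j)) => y _; rewrite mxE. Qed.
End Germs.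

Section Composition.
Local Open Scope classical_set_scope.
Variables (F : fieldType) (m n k l : nat).
Implicit Types (S : set 'M[F]_(m, n)).
Implicit Types (Phi : 'M[F]_(m, n) -> 'M[F]_(k, l)) (f : 'M[F]_(k, l) -> F).

Lemma regular_at_comp S x (S' : set 'M[F]_(k, l)) Phi f :
  S x -> (forall y, S y -> S' (Phi y)) -> regular_mx_at S x Phi ->
  regular_at S' (Phi x) f -> regular_at S x (f \o Phi).
Proof.
move=> Sx SS' rP [a [b [bx bf]]].
have poly p : regular_at S x (fun y => mxeval p (Phi y)).
  apply: (@regular_at_eq _ _ _ _ _ _ (fun y =>
    \sum_(e <- msupp p) p@_e * \prod_i mxvec (Phi y) 0 i ^+ e i)).
    by move=> y _; rewrite /mxeval mevalE.
  apply: regular_at_sum => e; apply: regular_atM; first exact: regular_at_cst.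
  apply: regular_at_prod => i; apply: regular_at_exp; case/mxvec_indexP: i => i j.
  by apply: (regular_at_eq _ (rP i j)) => y _; rewrite mxvecE.
apply: (@regular_at_near _ _ _ _ S _ _ (fun y => mxeval a (Phi y) / mxeval b (Phi y))).
  have [p [px pP]] := @regular_at_neq0 _ _ _ S x (fun y => mxeval b (Phi y)) Sx bx (poly b).
  by exists p; split=> // y Sy py; split=> //; apply: bf; [exact: SS' | exact: pP].
by apply: regular_atM => //; apply: regular_atV.
Qed.

Lemma near_in_comp S x (S' : set 'M[F]_(k, l)) Phi (P : set 'M[F]_(k, l)) :
  S x -> (forall y, S y -> S' (Phi y)) -> regular_mx_at S x Phi ->
  near_in S' (Phi x) P -> near_in S x (Phi @^-1` P).
Proof.
move=> Sx SS' rP [p [px pP]].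
have rp := regular_at_comp Sx SS' rP (regular_at_poly S' (Phi x) p).
have [q [qx qP]] := @regular_at_neq0 _ _ _ S x (mxeval p \o Phi) Sx px rp.
by exists q; split=> // y Sy qy; apply: pP; [exact: SS' | exact: qP].
Qed.

End Composition.

Section Spaces.
Local Open Scope classical_set_scope.
Variables (F : fieldType) (m n : nat).
Implicit Types (S W : set 'M[F]_(m, n)).

Lemma opens_subspace S W :
  opens (subspace (mxspace F m n) S) W <-> W `<=` S /\ forall x, W x -> near_in S x W.
Proof.
split=> [[U [E ->] ->]|[WS WP]].
  split=> [y [_ Sy]//|x [[p Ep px] Sx]]; exists p; split=> // y Sy py.
  by split=> //; exists p.
pose E := [set p : {mpoly F[m * n]} | forall y, S y -> mxeval p y != 0 -> W y].
exists [set A | exists2 p, E p & mxeval p A != 0]; first by exists E.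
apply/seteqP; split=> [x Wx|x [[p Ep px] Sx]]; last exact: Ep.
by split; [have [p [px pW]] := WP x Wx; exists p | exact: WS].
Qed.

Lemma regular_subspace S W (g : 'M[F]_(m, n) -> F) :
  regular (subspace (mxspace F m n) S) W g <-> forall x, W x -> regular_at W x g.
Proof.
split=> H x Wx.
  have [U [h [[E UE] Ux hU gh]]] := H x Wx.
  have [a [b [bx bh]]] := hU x Ux.
  apply: (@regular_at_near _ _ _ _ U _ _ h); last by exists a, b.
  move: (Ux); rewrite {1}UE => -[p Ep px]; exists p; split=> // y Wy py.
  have Uy : U y by rewrite UE; exists p.
  by split=> //; exact: gh.
have [a [b [bx bg]]] := H x Wx.
exists [set A | exists2 p, [set b] p & mxeval p A != 0], (fun A => mxeval a A / mxeval b A).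
split; [by exists [set b] | by exists b | | by move=> y Wy [_ -> by0]; exact: bg].
by move=> A [_ -> bA]; exists a, b.
Qed.

Variables (T' : Type) (c : 'M[F]_(m, n) -> T').

Lemma opens_quotient S (W : set T') :
  opens (quotient_space (subspace (mxspace F m n) S) c) W <->
  W `<=` c @` S /\ forall x, S x -> W (c x) -> near_in S x (c @^-1` W).
Proof.
rewrite /quotient_space /= setTI; split=> [[WS /opens_subspace[_ P]]|[WS P]]; split=> //.
  by move=> x Sx Wx; have [p [px pW]] := P x (conj Sx Wx); exists p; split=> // y Sy /(pW y Sy)[].
apply/opens_subspace; split=> [x []//|x [Sx Wx]].
by have [p [px pW]] := P x Sx Wx; exists p; split=> // y Sy py; split=> //; exact: pW.
Qed.

Lemma regular_quotient S (W : set T') g :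
  regular (quotient_space (subspace (mxspace F m n) S) c) W g <->
  forall x, S x -> W (c x) -> regular_at (S `&` c @^-1` W) x (g \o c).
Proof.
have pS : points (subspace (mxspace F m n) S) = S by exact: setTI.
rewrite -[regular _ _ _]/(regular (subspace (mxspace F m n) S)
  (points (subspace (mxspace F m n) S) `&` c @^-1` W) (g \o c)).
rewrite pS; split=> [/regular_subspace P x Sx Wx|P]; first exact: P.
by apply/regular_subspace => x [Sx Wx]; exact: P.
Qed.
End Spaces.

(** * Regularity of the octonion constructions *)

Section OctonionGerms.
Variables (F : fieldType) (m n : nat) (S : set 'M[F]_(m, n)) (x : 'M[F]_(m, n)).
Implicit Types (phi psi : 'M[F]_(m, n) -> octonion F).

Lemma regular_zalpha phi : regular_mx_at S x phi -> regular_at S x (fun y => zalpha (phi y)).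
Proof. by move=> r; apply: (regular_usubmx (regular_usubmx r)). Qed.
Lemma regular_zbeta phi : regular_mx_at S x phi -> regular_at S x (fun y => zbeta (phi y)).
Proof. by move=> r; apply: (regular_dsubmx (regular_dsubmx r)). Qed.
Lemma regular_zu phi : regular_mx_at S x phi -> regular_mx_at S x (fun y => zu (phi y)).
Proof. by move=> r; apply: (regular_dsubmx (regular_usubmx r)). Qed.
Lemma regular_zv phi : regular_mx_at S x phi -> regular_mx_at S x (fun y => zv (phi y)).
Proof. by move=> r; apply: (regular_usubmx (regular_dsubmx r)). Qed.

Lemma regular_zorn al u v be :
  regular_at S x al -> regular_mx_at S x u -> regular_mx_at S x v -> regular_at S x be ->
  regular_mx_at S x (fun y => zorn (al y) (u y) (v y) (be y)).
Proof.
have scal f : regular_at S x f -> regular_mx_at S x (fun y => (f y)%:M : 'M_1).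
  by move=> r i j; apply: (regular_at_eq _ r) => y _; rewrite !ord1 mxE.
move=> ral ru rv rbe; apply: regular_col_mx; apply: regular_col_mx => //; exact: scal.
Qed.

Lemma regular_dot u v : regular_mx_at S x u -> regular_mx_at S x v ->
  regular_at S x (fun y => dot (u y) (v y)).
Proof. by move=> ru rv; apply: regular_at_sum => i; apply: regular_atM. Qed.

Lemma regular_cross u v : regular_mx_at S x u -> regular_mx_at S x v ->
  regular_mx_at S x (fun y => cross (u y) (v y)).
Proof.
move=> ru rv i j.
apply: (@regular_at_eq _ _ _ _ _ _ (fun y =>
  u y (i + 1) 0 * v y (i + 2%:R) 0 - u y (i + 2%:R) 0 * v y (i + 1) 0)).
  by move=> y _; rewrite mxE.
by apply: regular_atD; [|apply: regular_atN]; apply: regular_atM.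
Qed.

Lemma regular_omul phi psi : regular_mx_at S x phi -> regular_mx_at S x psi ->
  regular_mx_at S x (fun y => omul (phi y) (psi y)).
Proof.
move=> r s.
have [ra sa] := (regular_zalpha r, regular_zalpha s).
have [rb sb] := (regular_zbeta r, regular_zbeta s).
have [ru su] := (regular_zu r, regular_zu s).
have [rv sv] := (regular_zv r, regular_zv s).
apply: regular_zorn.
- by apply: regular_atD; [exact: regular_atM | exact: regular_dot].
- apply: regular_mxD; last by apply: regular_mxN; exact: regular_cross.
  by apply: regular_mxD; exact: regular_mxZ.
- by apply: regular_mxD; [apply: regular_mxD; exact: regular_mxZ | exact: regular_cross].
- by apply: regular_atD; [exact: regular_atM | exact: regular_dot].
Qed.

Lemma regular_onorm phi : regular_mx_at S x phi -> regular_at S x (fun y => onorm (phi y)).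
Proof.
move=> r; apply: regular_atD; last first.
  by apply: regular_atN; apply: regular_dot; [exact: regular_zu | exact: regular_zv].
by apply: regular_atM; [exact: regular_zalpha | exact: regular_zbeta].
Qed.

Lemma regular_oconj phi : regular_mx_at S x phi -> regular_mx_at S x (fun y => oconj (phi y)).
Proof.
move=> r; apply: regular_zorn; [exact: regular_zbeta| | |exact: regular_zalpha].
  by apply: regular_mxN; exact: regular_zu.
by apply: regular_mxN; exact: regular_zv.
Qed.

Lemma regular_Lop phi : regular_mx_at S x phi -> regular_mx_at S x (fun y => Lop (phi y)).
Proof.
move=> r i j; apply: (@regular_at_eq _ _ _ _ _ _ (fun y => omul (phi y) (delta_mx j 0) i 0)).
  by move=> y _; rewrite -Lop_mul -colE [RHS]mxE.
exact: (regular_omul r (regular_mx_cst S x _)).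
Qed.

Lemma regular_Rop phi : regular_mx_at S x phi -> regular_mx_at S x (fun y => Rop (phi y)).
Proof.
move=> r i j; apply: (@regular_at_eq _ _ _ _ _ _ (fun y => omul (delta_mx j 0) (phi y) i 0)).
  by move=> y _; rewrite -Rop_mul -colE [RHS]mxE.
exact: (regular_omul (regular_mx_cst S x _) r).
Qed.
End OctonionGerms.

Section OperatorGerms.
Variables (F : closedFieldType) (S : set (operator F)) (x : operator F).

Lemma regular_bimul (phi : operator F -> octonion F) :
  regular_mx_at S x phi -> regular_mx_at S x (fun y => bimul (phi y)).
Proof. by move=> r; apply: regular_mxM; [exact: regular_Lop | exact: regular_Rop]. Qed.

Lemma regular_theta : regular_mx_at S x (@theta F).
Proof.
have rconj e : regular_mx_at S x (fun h => conj_Lop h e).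
  have radj : regular_mx_at S x (fun h : operator F => \adj h).
    by apply: regular_adj; exact: regular_mx_id.
  apply: regular_mxM (radj); apply: regular_mxM; first exact: regular_mx_id.
  by apply: regular_Lop; apply: (regular_mxM radj); exact: regular_mx_cst.
have rcorner e : regular_mx_at S x (fun h => corner (conj_Lop h) e).
  by apply: regular_mxM => //; apply: regular_mxM.
apply: regular_mxM; last exact: regular_mx_cst.
apply: regular_mxD; last exact: regular_mx_cst.
apply: regular_mxD; last by apply: regular_mxN; apply: regular_mxM.
apply: regular_mxD; last by apply: regular_mxN; apply: regular_mxM.
by apply: regular_mxD => //; apply: regular_mxN.
Qed.

Variable t : transport F.

Lemma regular_transported : regular_mx_at S x (transported t).
Proof.
have rA e : regular_mx_at S x (fun A => tr_left t *m A *m tr_right t *m e : octonion F).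
  apply: regular_mxM; last exact: regular_mx_cst.
  apply: regular_mxM; last exact: regular_mx_cst.
  by apply: regular_mxM; [exact: regular_mx_cst | exact: regular_mx_id].
have ra e := regular_zalpha (rA e); have rb e := regular_zbeta (rA e).
apply: regular_mxD; first exact: regular_mxZ.
apply: regular_mxZ; last exact: regular_mx_cst.
by apply: regular_atD; [|apply: regular_atN]; apply: regular_atM.
Qed.

Lemma regular_witness (phi : operator F -> octonion F) :
  regular_mx_at S x phi -> regular_mx_at S x (fun y => normal_witness (phi y)).
Proof.
move=> r; have rv := regular_zv r.
apply: regular_zorn => //; last exact: regular_atN.
  apply: regular_mxZ; last exact: regular_mx_cst.
  by apply: regular_atD; [exact: regular_zbeta | apply: regular_atN; exact: regular_zalpha].
exact: regular_mx_cst.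
Qed.

Let regular_transported_witness := regular_witness regular_transported.
Let regular_transported_conj := regular_oconj regular_transported.

Lemma regular_local_denom : regular_at S x (local_denom t).
Proof.
by apply: regular_atM; apply: regular_onorm => //; apply: regular_omul.
Qed.

Lemma regular_local_lift : S x -> local_denom t x != 0 -> regular_mx_at S x (local_lift t).
Proof.
move=> Sx Dx; apply: regular_mxM; first exact: regular_mx_cst.
apply: regular_mxZ; first exact: (regular_atV Sx Dx regular_local_denom).
by apply: regular_mxM; apply: regular_bimul => //; apply: regular_omul.
Qed.
End OperatorGerms.

(** * The isomorphism of varieties *)

Section Isomorphism.
Local Open Scope classical_set_scope.
Variable F : closedFieldType.
Hypothesis F2 : 2%:R != 0 :> F.
Variable rho : set (operator F) -> set (operator F).
Hypothesis Hrho : is_triality rho.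
Implicit Types (h k A B : operator F) (X Y : set (operator F)).

Local Notation SO8 := (@SO8 F).
Local Notation SO7 := (@SO7 F).
Local Notation coset := (fun h => lcoset h (@AutO F)).

Lemma opens_PSO8 U : opens (PSO8 F) U <->
  U `<=` (@pclass F) @` SO8 /\
  forall A, SO8 A -> U (pclass A) -> near_in SO8 A ((@pclass F) @^-1` U).
Proof. exact: opens_quotient. Qed.

Lemma regular_PSO8 U g : regular (PSO8 F) U g <->
  forall A, SO8 A -> U (pclass A) -> regular_at (SO8 `&` (@pclass F) @^-1` U) A (g \o @pclass F).
Proof. exact: regular_quotient. Qed.

Lemma points_V X : points (V_variety F) X <-> exists2 h, SO7 h & X = fmap rho h.
Proof.
split=> [[_ [c nc <-]]|[h sh ->]].
  by have [h sh E] := fmap_surjective F2 Hrho nc; exists h.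
have [sT ET] := theta_Pbar F2 Hrho sh; split; first by apply/points_PSO8; exists (theta h).
have [c nc Rc] := SO7_twist F2 Hrho sh; exists c => //.
by rewrite (fmap_Pbar F2 Rc sh.2) -mulmxA sh.2 Rop_mul omul1l.
Qed.

Lemma Pbar_image X : (@Pbar F @` @O1 F) X <-> points (V_variety F) X.
Proof.
split=> [[c nc <-]|[]//]; apply/points_V.
by have [h sh E] := fmap_surjective F2 Hrho nc; exists h.
Qed.

Lemma fmap_morphism : is_morphism (SO7_variety F) (V_variety F) (fmap rho).
Proof.
have pS : points (SO7_variety F) = SO7 by exact: setTI.
split; first by rewrite pS => h sh; apply/points_V; exists h.
move=> W [U oU WE]; rewrite pS.
have thetaS h : SO7 h -> SO8 (theta h) by move=> sh; have [] := theta_Pbar F2 Hrho sh.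
have thetaE h : SO7 h -> pclass (theta h) = fmap rho h by move=> sh; have [] := theta_Pbar F2 Hrho sh.
have WU h : SO7 h -> W (fmap rho h) <-> U (pclass (theta h)).
  move=> sh; rewrite thetaE // WE; split=> [[]//|Uh]; split=> //.
  by apply/Pbar_image/points_V; exists h.
have near_preimage U' h : opens (PSO8 F) U' -> SO7 h -> U' (pclass (theta h)) ->
    near_in SO7 h [set k | U' (pclass (theta k))].
  move=> /opens_PSO8[_ P] sh Uh.
  exact: (near_in_comp sh thetaS (regular_theta SO7 h) (P _ (thetaS h sh) Uh)).
split.
  apply/opens_subspace; split=> [h []//|h [sh /(WU _ sh) Uh]].
  have [p [px pP]] := near_preimage U h oU sh Uh; exists p; split; [exact: px | move=> k sk pk].
  by split; [exact: sk | apply/(WU k sk); exact: pP].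
move=> g rg; apply/regular_subspace => h [sh Wh].
have [U' [g' [oU' Uh /regular_PSO8 rg' gg']]] := rg _ Wh.
rewrite -thetaE // in Uh.
pose S0 := (SO7 `&` fmap rho @^-1` W) `&` [set k | U' (pclass (theta k))].
apply: (@regular_at_near _ _ _ _ S0 _ _ ((g' \o @pclass F) \o @theta F)).
  have [p [px pP]] := near_preimage U' h oU' sh Uh; exists p; split; [exact: px | move=> k [sk Wk] pk].
  have Uk := pP k sk pk; split; first by split.
  by rewrite /= thetaE //; apply: gg' => //; rewrite -thetaE.
apply: (regular_at_comp (S' := SO8 `&` @pclass F @^-1` U')).
- by split; [split | exact: Uh].
- by move=> k [[sk _] Uk]; split; [exact: thetaS | exact: Uk].
- exact: regular_theta.
- by apply: rg' => //; exact: thetaS.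
Qed.

Definition to_V C := fmap rho (xget 0 [set h | SO7 h /\ coset h = C]).
Definition from_V X := coset (xget 0 [set h | SO7 h /\ fmap rho h = X]).

Lemma to_V_coset h : SO7 h -> to_V (coset h) = fmap rho h.
Proof.
move=> sh; rewrite /to_V; case: xgetP => [k _ [sk Ek]|/(_ h)[]//].
by apply/(fmap_lcoset F2 Hrho).
Qed.

Lemma from_V_fmap h : SO7 h -> from_V (fmap rho h) = coset h.
Proof.
move=> sh; rewrite /from_V; case: xgetP => [k _ [sk Ek]|/(_ h)[]//].
by apply/(fmap_lcoset F2 Hrho).
Qed.

Lemma to_V_morphism : is_morphism (SO7_mod_G F) (V_variety F) to_V.
Proof.
have pS : points (SO7_variety F) = SO7 by exact: setTI.
have pQ C : points (SO7_mod_G F) C <-> exists2 h, SO7 h & C = coset h.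
  split=> [[h]|[h sh ->]]; last by exists h => //; rewrite pS.
  by rewrite -/(SO7_variety F) pS => sh <-; exists h.
have [_ M] := fmap_morphism; split=> [C /pQ[h sh ->]|W oW].
  by rewrite to_V_coset //; apply/points_V; exists h.
have [/opens_subspace[_ oP] rP] := M W oW; rewrite pS in oP rP.
split.
  apply/opens_quotient; split=> [C [/pQ[h sh ->] _]|h sh [_]]; first by exists h.
  rewrite /preimage /= to_V_coset // => Wh.
  have [p [px pP]] := oP h (conj sh Wh); exists p; split=> // k sk pk.
  by split; [apply/pQ; exists k | rewrite /= to_V_coset //; have [] := pP k sk pk].
move=> g /rP/regular_subspace rg; apply/regular_quotient => h sh [_].
rewrite /preimage /= to_V_coset // => Wh.
apply: regular_at_near (rg h (conj sh Wh)); apply: near_inT => k [sk [_]].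
by rewrite /preimage /= to_V_coset.
Qed.

(** The open sets of PSO(8) on which a local section is defined and a given polynomial
    does not vanish at its value. They descend from SO(8) because the section is
    even. *)
Section Distinguished.
Variables (t : transport F) (p : {mpoly F[(1 + 3 + (3 + 1)) * (1 + 3 + (3 + 1))]}).

Definition distinguished : set (set (operator F)) :=
  [set X | exists A, [/\ SO8 A, X = pclass A, local_denom t A != 0 & mxeval p (local_lift t A) != 0]].

Lemma distinguishedE A : SO8 A ->
  distinguished (pclass A) <-> local_denom t A != 0 /\ mxeval p (local_lift t A) != 0.
Proof.
move=> sA; split=> [[B [_ /pclass_eq E DB pB]]|[DA pA]]; last by exists A.
by case: E => ->; rewrite ?local_denomN ?local_liftN.
Qed.

Lemma opens_distinguished : opens (PSO8 F) distinguished.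
Proof.
apply/opens_PSO8; split=> [_ [A [sA -> _ _]]|A sA]; first by exists A.
move=> /(distinguishedE sA)[DA pA].
have rp := regular_at_comp sA (fun _ _ => I) (regular_local_lift sA DA) (regular_at_poly setT _ p).
have nD := regular_at_neq0 sA DA (regular_local_denom SO8 A t).
have np := @regular_at_neq0 _ _ _ SO8 A (mxeval p \o local_lift t) sA pA rp.
apply: near_inI nD np => B sB DB pB.
by apply/(distinguishedE sB).
Qed.

Lemma regular_distinguished a g :
  (forall A, SO8 A -> distinguished (pclass A) ->
     g (pclass A) = mxeval a (local_lift t A) / mxeval p (local_lift t A)) ->
  regular (PSO8 F) distinguished g.
Proof.
move=> gE; apply/regular_PSO8 => A sA DA.
have [D0 p0] := (distinguishedE sA).1 DA.
pose S := SO8 `&` @pclass F @^-1` distinguished.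
have SA : S A by [].
apply: (@regular_at_eq _ _ _ _ _ _
  (fun B => mxeval a (local_lift t B) * (mxeval p (local_lift t B))^-1)).
  by move=> B [sB DB]; exact: gE.
have rl : regular_mx_at S A (local_lift t) by exact: regular_local_lift.
have rq q : regular_at S A (mxeval q \o local_lift t).
  exact: (regular_at_comp SA (fun _ _ => I) rl (regular_at_poly setT _ q)).
apply: regular_atM; first exact: rq.
exact: (regular_atV SA p0 (rq p)).
Qed.
End Distinguished.

(** Near each point the inverse of the induced map is a local section of f followed by
    the quotient map, so openness and regularity are inherited from SO(7). *)
Lemma from_V_morphism : is_morphism (V_variety F) (SO7_mod_G F) from_V.
Proof.
have pS : points (SO7_variety F) = SO7 by exact: setTI.
split=> [X /points_V[h sh ->]|W oW].
  by rewrite from_V_fmap //; exists h => //; rewrite pS.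
set WV := points (V_variety F) `&` from_V @^-1` W.
have [_ oP] := (opens_quotient _ _ _).1 oW.
(* Near X a single transport t gives representatives of all the cosets from_V Y. *)
have local X : WV X -> exists t A, [/\ SO8 A, X = pclass A, SO7 (local_lift t A),
    W (coset (local_lift t A)) &
    local_denom t A != 0 /\
    forall B Y, SO8 B -> Y = pclass B -> points (V_variety F) Y -> local_denom t B != 0 ->
      SO7 (local_lift t B) /\ from_V Y = coset (local_lift t B)].
  move=> [/points_V[h sh ->] Wh].
  have [sT ET] := theta_Pbar F2 Hrho sh.
  have [t [D L]] := local_section F2 Hrho sh.
  have D0 := D (theta h) (esym ET).
  have [s1 E1] := L _ _ sh (esym ET) D0.
  exists t, (theta h); split; [exact: sT | exact: ET | exact: s1 | |].
    by rewrite -(from_V_fmap s1) E1 -ET; exact: Wh.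
  split; first exact: D0.
  move=> B Y sB YE /points_V[k sk Yk] DB.
  have [s2 E2] := L B k sk (etrans (esym YE) Yk) DB.
  by split; [exact: s2 | rewrite -(from_V_fmap s2) E2 YE].
split.
  exists [set X | exists U, [/\ opens (PSO8 F) U, U X & U `&` points (V_variety F) `<=` WV]].
    apply/opens_PSO8; split=> [X [U [/opens_PSO8[UP _] UX _]]|A sA [U [oU UA UW]]]; first exact: UP.
    have [_ /(_ A sA UA)[p [px pP]]] := (opens_PSO8 U).1 oU.
    by exists p; split=> // B sB pB; exists U; split=> //; exact: pP.
  apply/seteqP; split=> [X WX|X [[U [oU UX UW]] /Pbar_image VX]]; last first.
    exact: UW.
  split; last by apply/Pbar_image; case: WX.
  have [t [A [sA XA sl Wl [D0 L]]]] := local X WX.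
  have [p [px pP]] := oP _ sl Wl.
  exists (distinguished t p); split; first exact: opens_distinguished.
    by rewrite XA; apply/(distinguishedE _ _ sA).
  move=> Y [[B [sB YB DB pB]] VY]; split; first exact: VY.
  have [s2 E2] := L B Y sB YB VY DB.
  by rewrite /preimage /= E2; exact: pP.
move=> g /regular_quotient rg X WX.
have [t [A [sA XA sl Wl [D0 L]]]] := local X WX.
have [a [b [b0 gE]]] := rg _ sl Wl.
(* A matrix representing Y; either of the two choices gives the same lift. *)
pose rep Y := xget 0 [set B | SO8 B /\ pclass B = Y].
exists (distinguished t b), (fun Y => mxeval a (local_lift t (rep Y)) / mxeval b (local_lift t (rep Y))).
have repE B : SO8 B -> local_lift t (rep (pclass B)) = local_lift t B.
  move=> sB; rewrite /rep; case: xgetP => [C _ [_ /pclass_eq[]->]|/(_ B)[]].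
  - reflexivity.
  - exact: local_liftN.
  - by split; [exact: sB | reflexivity].
split; [exact: opens_distinguished | by rewrite XA; apply/(distinguishedE _ _ sA) | |].
  by apply: regular_distinguished => B sB _; rewrite repE.
move=> Y [VY WY] [B [sB YB DB bB]].
have [s2 E2] := L B Y sB YB VY DB.
rewrite [in RHS]YB (repE B sB) -gE; [by rewrite /comp E2 | | exact: bB].
by split; [exact: s2 | rewrite /preimage /= -E2; exact: WY].
Qed.

Lemma to_V_isomorphism : is_isomorphism (SO7_mod_G F) (V_variety F) to_V.
Proof.
have pS : points (SO7_variety F) = SO7 by exact: setTI.
split; first exact: to_V_morphism.
exists from_V; split; first exact: from_V_morphism.
- move=> C [h]; rewrite -/(SO7_variety F) pS => sh <-.
  by rewrite to_V_coset // from_V_fmap.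
- by move=> X /points_V[h sh ->]; rewrite from_V_fmap // to_V_coset.
Qed.

End Isomorphism.

Theorem theorem5p8 (F : closedFieldType) (charF : 2%N \notin [pchar F])
    (rho : set (operator F) -> set (operator F)) (Hrho : is_triality rho) :
  is_morphism (SO7_variety F) (V_variety F) (fmap rho) /\
  exists phi : set (operator F) -> set (operator F),
    (forall h : operator F, SO7 h -> phi (lcoset h (@AutO F)) = fmap rho h) /\
    is_isomorphism (SO7_mod_G F) (V_variety F) phi.
Proof.
have F2 : 2%:R != 0 :> F by move: charF; rewrite inE.
split; first exact: fmap_morphism.
exists (to_V rho); split; last exact: to_V_isomorphism.
exact: to_V_coset.
Qed.
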